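(* Let $N\ge 3$, let $n\geq 1$, let $a_1,\dots,a_n$ be $n$ different points of $\mathbb{R}^N$ and let $\alpha_1,\dots,\alpha_n\ge 0$ with $\sum_{i=1}^n\alpha_i=1$. Then for every $u\in H^1(\mathbb{R}^N)$ $$\int_{\mathbb{R}^N}|\nabla u|^2\,dx\ \ge\ \frac{(N-2)^2}{4}\sum_{i=1}^n\int_{\mathbb{R}^N}\alpha_i\frac{|u|^2}{|x-a_i|^2}\,dx,$$ and the constant $\frac{(N-2)^2}{4}$ is sharp. Especially, for every $u\in H^1(\mathbb{R}^N)$ $$\int_{\mathbb{R}^N}|\nabla u|^2\,dx\ \ge\ \frac{(N-2)^2}{4n}\sum_{i=1}^n\int_{\mathbb{R}^N}\frac{|u|^2}{|x-a_i|^2}\,dx,$$ and the constant $\frac{(N-2)^2}{4n}$ is sharp.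
   Context: ''Sharp'' means that the corresponding inequality fails for some $u\in H^1(\mathbb{R}^N)$ if the constant is replaced by any larger constant. *)

(* Defs.v *)
From HB Require Import structures.
From mathcomp Require Import all_boot all_order all_algebra.
From mathcomp Require Import all_classical all_reals all_analysis.
Set Implicit Arguments.
Unset Strict Implicit.
Unset Printing Implicit Defensive.
Import Order.TTheory GRing.Theory Num.Theory.
Import numFieldNormedType.Exports.
Local Open Scope classical_set_scope.
Local Open Scope ring_scope.

Definition rV_display : measure_display.
Proof. exact: default_measure_display. Qed.

(* The sigma-algebra on 'rV[R]_n generated by the coordinates, i.e. the Borel
   sigma-algebra of R^n (the same construction as for n.-tuple T in the
   library). *)
Section measurable_rV.
Variables (R : realType) (n : nat).

Definition rV_coord (i : 'I_n) (x : 'rV[R]_n) : measurableTypeR R := x 0 i.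

Let rV_set0 : g_sigma_preimage rV_coord set0.
Proof. exact: sigma_algebra0. Qed.

Let rV_setC A : g_sigma_preimage rV_coord A -> g_sigma_preimage rV_coord (~` A).
Proof. exact: sigma_algebraC. Qed.

Let rV_bigcup (F : _^nat) : (forall i, g_sigma_preimage rV_coord (F i)) ->
  g_sigma_preimage rV_coord (\bigcup_i (F i)).
Proof. exact: sigma_algebra_bigcup. Qed.

HB.instance Definition _ := @isMeasurable.Build rV_display
  'rV[R]_n (g_sigma_preimage rV_coord) rV_set0 rV_setC rV_bigcup.

Lemma measurable_rV_coord (i : 'I_n) : measurable_fun setT (rV_coord i).
Proof.
move=> _ Y mY; rewrite setTI; apply: sub_sigma_algebra => /=.
rewrite -bigcup_seq/=; exists i => /=; first by rewrite mem_index_enum.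
by exists Y => //; rewrite setTI.
Qed.

Lemma measurable_fun_rV d (T : measurableType d) (f : T -> 'rV[R]_n) :
  (forall i, measurable_fun setT (rV_coord i \o f)) -> measurable_fun setT f.
Proof.
move=> mf; have h : g_sigma_preimage (fun i => rV_coord i \o f) `<=` measurable.
  apply: smallest_sub; first exact: sigma_algebra_measurable.
  rewrite -bigcup_seq/=; apply: bigcup_sub => i _ A [B mB <-]; exact: mf.
move=> _ A mA; apply: h; rewrite g_sigma_preimage_comp.
by exists A.
Qed.

End measurable_rV.

(* R^(n+1) = R * R^n: first coordinate, and remaining coordinates *)
Section rV_cons.
Variables (R : realType) (n : nat).

Definition rV_cons (p : measurableTypeR R * 'rV[R]_n) : 'rV[R]_n.+1 :=
  \row_i (if unlift ord0 i is Some j then p.2 0 j else p.1).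

Definition rV_uncons (x : 'rV[R]_n.+1) : measurableTypeR R * 'rV[R]_n :=
  (x 0 ord0, \row_j x 0 (lift ord0 j)).

Lemma rV_consK : cancel rV_cons rV_uncons.
Proof.
case=> x v; rewrite /rV_uncons /rV_cons !mxE unlift_none; congr (_, _).
by apply/rowP => j; rewrite !mxE liftK.
Qed.

Lemma rV_unconsK : cancel rV_uncons rV_cons.
Proof.
move=> x; apply/rowP => i; rewrite !mxE /=.
by case: unliftP => [j|] ->; rewrite ?mxE.
Qed.

Lemma measurable_rV_cons : measurable_fun setT rV_cons.
Proof.
apply: measurable_fun_rV => i.
case: (unliftP ord0 i) => [j|] ->.
  rewrite (_ : _ \o _ = @rV_coord R n j \o snd).
    by apply: measurableT_comp => //; exact: measurable_rV_coord.
  by apply/funext => p; rewrite /rV_coord /= mxE liftK.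
rewrite (_ : _ \o _ = fst) //.
by apply/funext => p; rewrite /rV_coord /= mxE unlift_none.
Qed.

Lemma measurable_rV_uncons : measurable_fun setT rV_uncons.
Proof.
apply/measurable_fun_pairP; split; first exact: (@measurable_rV_coord R n.+1 ord0).
apply: measurable_fun_rV => j.
rewrite (_ : _ \o _ = @rV_coord R n.+1 (lift ord0 j)).
  exact: measurable_rV_coord.
by apply/funext => x; rewrite /rV_coord /= mxE.
Qed.

End rV_cons.

Section leb_rV_succ.
Context (R : realType) (n : nat).
Variable m : {sigma_finite_measure set 'rV[R]_n -> \bar R}.

Definition leb_rV_succ : set 'rV[R]_n.+1 -> \bar R :=
  pushforward (@lebesgue_measure R \x m)%E (@rV_cons R n).

Let mcons := @measurable_rV_cons R n.

Let leb_rV_succ0 : leb_rV_succ set0 = 0%E.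
Proof. by rewrite /leb_rV_succ /pushforward preimage_set0 measure0. Qed.

Let leb_rV_succ_ge0 A : (0 <= leb_rV_succ A)%E.
Proof. exact: measure_ge0. Qed.

Let leb_rV_succ_sigma_additive : semi_sigma_additive leb_rV_succ.
Proof.
move=> F mF tF mUF; rewrite /leb_rV_succ /pushforward preimage_bigcup.
apply: measure_semi_sigma_additive.
- by move=> k; rewrite -[X in measurable X]setTI; exact: mcons.
- apply/trivIsetP => /= i j _ _ ij; rewrite -preimage_setI.
  by move/trivIsetP : tF => /(_ _ _ _ _ ij) ->//; rewrite preimage_set0.
- by rewrite -preimage_bigcup -[X in measurable X]setTI; exact: mcons.
Qed.

HB.instance Definition _ := isMeasure.Build _ _ _ leb_rV_succ
  leb_rV_succ0 leb_rV_succ_ge0 leb_rV_succ_sigma_additive.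

Let leb_rV_succ_sigma_finite : sigma_finite setT leb_rV_succ.
Proof.
have /sigma_finiteP[F [FT ndF Foo]] := sigma_finiteT (@lebesgue_measure R).
have /sigma_finiteP[G [GT ndG Goo]] := sigma_finiteT m.
exists (fun k => @rV_uncons R n @^-1` (F k `*` G k)).
  apply/seteqP; split=> // x _.
  have : (\bigcup_k F k) (rV_uncons x).1 by rewrite -FT.
  have : (\bigcup_k G k) (rV_uncons x).2 by rewrite -GT.
  move=> [k _ Gk] [l _ Fl]; exists (maxn k l) => //; split.
    by apply: (subsetPset _ _ (ndF l (maxn k l) (leq_maxr _ _))).
  by apply: (subsetPset _ _ (ndG k (maxn k l) (leq_maxl _ _))).
move=> k; have [mF Fk] := Foo k; have [mG Gk] := Goo k; split.
  rewrite -[X in measurable X]setTI; apply: measurable_rV_uncons => //.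
  exact: measurableX.
rewrite /leb_rV_succ /pushforward -comp_preimage.
rewrite (_ : _ \o _ = id); last by apply/funext => p /=; rewrite rV_consK.
by rewrite preimage_id product_measure1E// lte_mul_pinfty// ge0_fin_numE.
Qed.

HB.instance Definition _ := Measure_isSigmaFinite.Build _ _ _ leb_rV_succ
  leb_rV_succ_sigma_finite.

End leb_rV_succ.

(* n-dimensional Lebesgue measure *)
Fixpoint leb_rV (R : realType) (n : nat)
    : {sigma_finite_measure set 'rV[R]_n -> \bar R} :=
  match n with
  | 0 => dirac (0 : 'rV[R]_0)
  | n'.+1 => leb_rV_succ (leb_rV R n')
  end.

(* Not used in the statement: this characterizes the measure leb_rV. *)
Lemma leb_rV_box (R : realType) (n : nat)
    (A : 'I_n -> set (measurableTypeR R)) :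
  (forall i, measurable (A i)) ->
  leb_rV R n [set x | forall i, A i (x 0 i)] =
    (\prod_(i < n) lebesgue_measure (A i))%E.
Proof.
elim: n A => [|n IH] A mA.
  rewrite big_ord0 /= diracE mem_set // => -[]//.
rewrite big_ord_recl /=.
rewrite /leb_rV_succ /pushforward -IH => [|i]; last exact: mA.
have mB : measurable
    ([set x | forall i, A (lift ord0 i) (x 0 i)] : set 'rV[R]_n).
  rewrite [X in measurable X](_ : _ =
    \bigcap_(i in [set: 'I_n]) (@rV_coord R n i @^-1` A (lift ord0 i))).
    apply: fin_bigcap_measurable => // i _; rewrite -[X in measurable X]setTI.
    exact: measurable_rV_coord.
  by apply/seteqP; split=> x /= h i => [_|]; exact: h.
rewrite -product_measure1E //.
congr (_ _); apply/seteqP; split=> -[x v] /= h.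
  split=> [|i]; first by have := h ord0; rewrite mxE unlift_none.
  by have := h (lift ord0 i); rewrite mxE liftK.
move=> i; rewrite mxE; case: unliftP => [j|] -> /=; last exact: h.1.
exact: h.2.
Qed.

Section sobolev.
Context (R : realType) (N : nat).
Implicit Types (u phi : 'rV[R]_N -> R) (g : 'rV[R]_N -> 'rV[R]_N).

(* Euclidean norm; the library's `|x| is the sup norm on 'rV[R]_N. *)
Definition enorm (x : 'rV[R]_N) : R := Num.sqrt (\sum_i x 0 i ^+ 2).

Definition partial (i : 'I_N) phi : 'rV[R]_N -> R := 'D_(delta_mx 0 i) phi.

Definition iter_partial (s : seq 'I_N) phi : 'rV[R]_N -> R :=
  foldr partial phi s.

Definition smooth phi : Prop := forall s : seq 'I_N,
  continuous (iter_partial s phi) /\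
  forall i x, derivable (iter_partial s phi) x (delta_mx 0 i).

Definition test_function phi : Prop :=
  smooth phi /\ compact (closure [set x | phi x != 0]).

Definition L2 u : Prop := u \in Lfun (leb_rV R N) 2%:E.

(* u belongs to H^1(R^N), with weak gradient g *)
Definition H1 u g : Prop :=
  [/\ L2 u,
      forall i, L2 (fun x => g x 0 i) &
      forall i phi, test_function phi ->
        (\int[leb_rV R N]_x (u x * partial i phi x)%:E =
         - \int[leb_rV R N]_x (g x 0 i * phi x)%:E)%E].

End sobolev.

(* Main.v *)
Require Import Defs.
From mathcomp Require Import all_boot all_order all_algebra.
From mathcomp Require Import all_classical all_reals all_analysis.
From mathcomp Require Import measurable_realfun zify ring lra.
Set Implicit Arguments.
Unset Strict Implicit.
Unset Printing Implicit Defensive.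
Import Order.TTheory GRing.Theory Num.Theory.
Import numFieldNormedType.Exports.
Local Open Scope classical_set_scope.
Local Open Scope ring_scope.

(** Why the inequality holds. The weights sum to 1, so the multipolar
    inequality is the average of Hardy inequalities with a single pole [a]; the
    second inequality is the case of equal weights. The function [u] is only
    known through its weak gradient [g], that is through integrals that are
    linear in [u], so Hardy's inequality is proved by duality, without ever
    differentiating [u ^ 2] and without mollifying [u].

    Spread a test function [phi] by dilations about the pole,
    [phi_t x = e^(-Nt) phi (a + e^(-t) (x - a))]. Its derivative in [t] is
    [- div ((x - a) phi_t)], hence the derivative of [t |-> int u phi_t] is
    [int g . (x - a) phi_t]. Since
    [int |x - a|^2 phi_t^2 = e^(-(N-2)t) int |x - a|^2 phi^2], Young's inequality
    bounds this derivative by a multiple of [e^(-(N-2)t/2)], which is integrable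
    on the half line because [N >= 3]; and [int u phi_t] tends to 0 because [u]
    is square integrable. Integrating over [t] gives (lemma [dual_hardy])

      [2 int u phi <= 4/(N-2)^2 int |g|^2 + int |x - a|^2 phi^2].

    Every bounded measurable function of bounded support is a limit of test
    functions for the L2 norm with weight [1 + |x - a|^2] (lemma
    [approximable_cube_bounded]), so the same holds with such a function in the
    place of [phi]. Taking the truncations of
    [u / |x - a|^2], the left side is [2 I] and the last term is [I], where [I]
    is the truncated Hardy integral; monotone convergence concludes (lemma
    [hardy]).

    Why the constant is sharp. In the variable [t = ln |x|^2] a dilation of the
    space is a translation, so the functional [F |-> int |x|^(-N) F (ln |x|^2)]
    is translation invariant and vanishes on derivatives (lemma
    [radint_derive]). The trial function is
    [u = e^(-(N-2)t/4) max (0, 1 - tau^2)^2] with [tau = (t - b)/L]. Its energy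
    density and [u^2/|x|^2] are [|x|^(-N)] times polynomials in [tau] and
    [max (0, 1 - tau^2)], and three applications of the vanishing on derivatives
    give the exact value (lemma [energy_trial])

      [int |grad u|^2 = ((N-2)^2/4 + 12/L^2) int u^2/|x|^2].

    A large [L] brings the constant close to [(N-2)^2/4]; then a large [b] pushes
    the support of [u] so far away that every [|x - a_i|] is at most
    [(1 + eta)^(1/2) |x|] on it, and the poles cannot be told from the origin
    (lemma [weighted_sharp]). *)

(** * Lebesgue measure: measurability of continuous functions, affine maps, cubes *)

Section lebesgue_rV.
Context {R : realType}.

Lemma measurable_coord (n : nat) (i : 'I_n) :
  measurable_fun setT (fun x : 'rV[R]_n => x 0 i).
Proof. exact: measurable_rV_coord. Qed.

(** The sigma-algebra is the one generated by the coordinates, so open sets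
    have to be exhausted by countably many boxes: those with rational centre and
    radius of the form 1/(k+1). *)
Lemma open_measurable_rV (n : nat) (U : set 'rV[R]_n) : open U -> measurable U.
Proof.
move=> oU.
(* Sup-norm balls with rational centre p.1 and radius 1/(p.2+1). *)
pose B (p : 'rV[rat]_n * nat) : set 'rV[R]_n :=
  [set x | forall i, `|x 0 i - ratr (p.1 0 i)| < p.2.+1%:R^-1].
have mB p : measurable (B p).
  rewrite (_ : B p = \bigcap_(i in [set: 'I_n])
     ((fun x : 'rV[R]_n => x 0 i) @^-1` [set t | `|t - ratr (p.1 0 i)| < p.2.+1%:R^-1])).
    apply: fin_bigcap_measurable => // i _; rewrite -[X in measurable X]setTI.
    apply: measurable_coord => //.
    rewrite (_ : [set t | _] = `](ratr (p.1 0 i) - p.2.+1%:R^-1), (ratr (p.1 0 i) + p.2.+1%:R^-1)[%classic).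
      exact: measurable_itv.
    by apply/seteqP; split=> t /=; rewrite in_itv/= ltr_distl.
  by apply/seteqP; split=> x /= h i => [_|]; exact: h.
pose F p := if `[< B p `<=` U >] then B p else set0.
rewrite (_ : U = \bigcup_p F p).
  by apply: countable_bigcupT_measurable => // p; rewrite /F; case: ifP.
apply/seteqP; split => [x Ux|x [p _]]; last first.
  by rewrite /F; case: asboolP => // pU Bx; exact: pU.
have [e /= e0 eU] : exists2 e : R, 0 < e & ball x e `<=` U.
  by have /nbhs_ballP[e /= e0 eU] := open_nbhs_nbhs (conj oU Ux); exists e.
pose k := Num.truncn (2 / e).
have k0 : 0 < k.+1%:R^-1 :> R by rewrite invr_gt0.
have ke : k.+1%:R^-1 + k.+1%:R^-1 <= e.
  have : 2 / e < k.+1%:R := truncnS_gt _.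
  rewrite ltr_pdivrMr// => h.
  by rewrite -(@ler_pM2r _ k.+1%:R)// mulrDl mulVf// mulrC ltW.
have hq (i : 'I_n) : exists q : rat, `|x 0 i - ratr q| < k.+1%:R^-1.
  have /rat_in_itvoo[q] : x 0 i - k.+1%:R^-1 < x 0 i + k.+1%:R^-1 by rewrite ltrBlDr -addrA ltrDl addr_gt0.
  rewrite in_itv /= => /andP[q1 q2]; exists q.
  by rewrite ltr_distl; apply/andP; split; [rewrite ltrBlDr|rewrite -ltrBlDr].
have [q qP] := choice hq.
exists (\row_i q i, k) => //; rewrite /F; case: asboolP => [_ i|[]]; first by rewrite /= mxE.
move=> y /= By; apply: eU; rewrite /ball /= /mx_ball; split=> // i j.
rewrite (ord1 i) /ball /=.
have := By j; have := qP j; rewrite mxE /= => h1 h2.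
apply: lt_le_trans ke.
rewrite (_ : x 0 j - y 0 j = (x 0 j - ratr (q j)) - (y 0 j - ratr (q j))); last by ring.
apply: le_lt_trans (ler_normB _ _) _; exact: ltrD.
Qed.

Lemma continuous_measurable_rV (n : nat) (f : 'rV[R]_n -> R) :
  continuous f -> measurable_fun setT f.
Proof.
move=> /continuousP cf.
apply: (measurability _ (RGenOInfty.measurableE R)) => /= _ [_ [a ->] <-].
by rewrite setTI; apply: open_measurable_rV; apply: cf; exact: rray_open.
Qed.

(** Tonelli for the splitting off of the first coordinate, by which the
    measure is defined; the engine of inductions on the dimension. *)
Lemma ge0_integral_rV_cons (n : nat) (f : 'rV[R]_n.+1 -> \bar R) :
  measurable_fun setT f -> (forall x, 0 <= f x)%E ->
  (\int[leb_rV R n.+1]_x f x =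
   \int[lebesgue_measure]_t \int[leb_rV R n]_v f (rV_cons (t, v)))%E.
Proof.
move=> mf f0 /=.
rewrite [LHS](_ : _ = \int[(@lebesgue_measure R \x leb_rV R n)%E]_p (f (rV_cons p)))%E.
  rewrite (@fubini_tonelli1 _ _ _ _ _ _ _ (fun p => f (rV_cons p)))//.
  by apply: measurableT_comp => //; exact: measurable_rV_cons.
rewrite -[LHS]/(\int[pushforward (@lebesgue_measure R \x leb_rV R n)%E (@rV_cons R n)]_x f x)%E.
rewrite ge0_integral_pushforward//.
exact: measurable_rV_cons.
Qed.

(** The image measure, rescaled, agrees with Lebesgue measure on half-open
    intervals, hence everywhere. *)
Lemma ge0_integral_affine1 (b c : R) (f : R -> \bar R) : 0 < c ->
  measurable_fun setT f -> (forall x, 0 <= f x)%E ->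
  (\int[@lebesgue_measure R]_t f (b + c * t)%R =
   c^-1%:E * \int[@lebesgue_measure R]_t f t)%E.
Proof.
move=> c0 mf f0.
pose h : measurableTypeR R -> measurableTypeR R := fun t => b + c * t.
have mh : measurable_fun setT h.
  by apply: measurable_funD => //; exact: measurable_funM.
pose cn : {nonneg R} := NngNum (ltW c0).
pose m_ : {measure set (measurableTypeR R) -> \bar R} :=
  mscale cn (pushforward (@lebesgue_measure R) h).
pose m := m_ mh.
have hm A : measurable A -> lebesgue_measure A = m A.
  apply: lebesgue_measure_unique => _ [[x y] _ <-].
  rewrite -[RHS]/(c%:E * lebesgue_measure (h @^-1` `]x, y]%classic))%E.
  rewrite (_ : h @^-1` _ = `](x - b) / c, (y - b) / c]%classic); last first.
    apply/seteqP; split=> t /=; rewrite /h !in_itv/= => /andP[h1 h2]; apply/andP; split.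
    - by rewrite ltr_pdivrMr// ltrBlDl mulrC.
    - by rewrite ler_pdivlMr// lerBrDl mulrC.
    - by move: h1; rewrite ltr_pdivrMr// ltrBlDl mulrC.
    - by move: h2; rewrite ler_pdivlMr// lerBrDl mulrC.
  rewrite !lebesgue_measure_itv /= !lte_fin ltr_pM2r ?invr_gt0// ltrD2r.
  case: ifP => _; last by rewrite mule0.
  by rewrite -!EFinB -EFinM; congr _%:E; field; rewrite gt_eqF.
rewrite [X in (_ * X)%E](@eq_measure_integral _ _ _ _ m); last by move=> A mA _; exact: hm.
rewrite ge0_integral_mscale// ge0_integral_pushforward//.
by rewrite muleA -EFinM mulVf ?gt_eqF// mul1e.
Qed.

Lemma measurable_affine (n : nat) (b : 'rV[R]_n) (c : R) :
  measurable_fun setT (fun x : 'rV[R]_n => b + c *: x).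
Proof.
apply: measurable_fun_rV => i.
rewrite (_ : _ \o _ = (fun x : 'rV[R]_n => b 0 i + c * x 0 i)); last first.
  by apply/funext => x; rewrite /rV_coord/= !mxE.
apply: measurable_funD => //; apply: measurable_funM => //.
exact: measurable_coord.
Qed.

Lemma ge0_integral_affine (n : nat) (b : 'rV[R]_n) (c : R) (f : 'rV[R]_n -> \bar R) :
  0 < c -> measurable_fun setT f -> (forall x, 0 <= f x)%E ->
  (\int[leb_rV R n]_x f (b + c *: x)%R =
   (c ^- n)%:E * \int[leb_rV R n]_x f x)%E.
Proof.
move=> c0; elim: n b f => [|n IH] b f mf f0.
  rewrite expr0 invr1 mul1e; apply: eq_integral => x _; congr (f _).
  by apply/rowP => -[].
have mfa : measurable_fun setT (fun x : 'rV[R]_n.+1 => f (b + c *: x)).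
  by apply: (measurableT_comp mf); exact: measurable_affine.
rewrite !ge0_integral_rV_cons//.
pose F (t : R) : \bar R := (\int[leb_rV R n]_v f (rV_cons (t, v)))%E.
have mFp : measurable_fun setT (fun p : measurableTypeR R * 'rV[R]_n => f (rV_cons p)).
  by apply: measurableT_comp => //; exact: measurable_rV_cons.
have mF : measurable_fun setT F.
  exact: (@measurable_fun_fubini_tonelli_F _ _ _ _ _ _ (fun p => f (rV_cons p))).
have F0 t : (0 <= F t)%E by apply: integral_ge0.
transitivity (\int[@lebesgue_measure R]_t ((c ^- n)%:E * F (b 0 ord0 + c * t)%R))%E.
  apply: eq_integral => t _.
  rewrite -(IH (\row_j b 0 (lift ord0 j))); first last.
  - by move=> x.
  - exact: (measurable_fun_pair2 _ mFp).
  apply: eq_integral => v _; congr (f _).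
  apply/rowP => i; rewrite !mxE.
  by case: (unliftP ord0 i) => [j|] ->; rewrite ?mxE.
rewrite ge0_integralZl//; last 2 first.
- by apply: (measurableT_comp mF); apply: measurable_funD => //; exact: measurable_funM.
- by rewrite lee_fin invr_ge0 exprn_ge0// ltW.
by rewrite ge0_integral_affine1// muleA -EFinM exprS invfM mulrC.
Qed.

(** Translations ([c = 1]) and dilations ([b] chosen according to the centre)
    are the only changes of variables that the proof needs. *)
Lemma integral_affine (n : nat) (b : 'rV[R]_n) (c : R) (f : 'rV[R]_n -> \bar R) :
  0 < c -> measurable_fun setT f ->
  (\int[leb_rV R n]_x f (b + c *: x)%R =
   (c ^- n)%:E * \int[leb_rV R n]_x f x)%E.
Proof.
move=> c0 mf; have mA := measurable_affine b c.
rewrite integralE [in RHS]integralE.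
under eq_integral do rewrite funepos_comp.
under [X in (_ - X)%E]eq_integral do rewrite funeneg_comp.
rewrite !ge0_integral_affine//; [|exact: measurable_funeneg|exact: measurable_funepos].
set x := (\int[leb_rV R n]_z f^\+ z)%E; set y := (\int[leb_rV R n]_z f^\- z)%E.
have cn0 : 0 < c ^- n by rewrite invr_gt0 exprn_gt0.
have x0 : (0 <= x)%E by apply: integral_ge0.
have y0 : (0 <= y)%E by apply: integral_ge0.
case: x x0 => [x| |] // x0; case: y y0 => [y| |] // y0.
- by rewrite -!EFinM -!EFinB mulrBr.
- by rewrite gt0_muley ?lte_fin//= gt0_muleNy ?lte_fin.
- by rewrite gt0_muley ?lte_fin//= gt0_muley ?lte_fin.
- by rewrite gt0_muley ?lte_fin//= gt0_muleNy ?lte_fin.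
Qed.

(** The closed ball of the sup norm, written without norm: it is the frame in
    which supports are bounded. *)
Definition cube (n : nat) (M : R) : set 'rV[R]_n := [set x | forall i, `|x 0 i| <= M].

Lemma measurable_box (n : nat) (A : 'I_n -> set (measurableTypeR R)) :
  (forall i, measurable (A i)) -> measurable [set x : 'rV[R]_n | forall i, A i (x 0 i)].
Proof.
move=> mA; rewrite [X in measurable X](_ : _ =
    \bigcap_(i in [set: 'I_n]) (@rV_coord R n i @^-1` A i)).
  apply: fin_bigcap_measurable => // i _; rewrite -[X in measurable X]setTI.
  exact: measurable_rV_coord.
by apply/seteqP; split=> x /= h i => [_|]; exact: h.
Qed.

Lemma cubeE (n : nat) (M : R) : cube M = [set x : 'rV[R]_n | forall i, `[- M, M]%classic (x 0 i)].
Proof.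
by apply/seteqP; split=> x h i; have := h i; rewrite /= in_itv/= ler_norml.
Qed.

Lemma measurable_cube (n : nat) (M : R) : measurable (cube M : set 'rV[R]_n).
Proof. by rewrite cubeE; apply: (measurable_box (A := fun=> `[- M, M]%classic)) => i; exact: measurable_itv. Qed.

Lemma lt_leb_cube (n : nat) (M : R) : (leb_rV R n (cube M) < +oo)%E.
Proof.
rewrite cubeE (leb_rV_box (A := fun=> `[- M, M]%classic)); last by move=> i; exact: measurable_itv.
rewrite (eq_bigr (fun=> (if - M < M then M + M else 0)%:E)) => [|i _].
  by rewrite prodEFin ltry.
rewrite lebesgue_measure_itv/= lte_fin; case: ifP => _ //.
by rewrite -EFinB opprK.
Qed.

End lebesgue_rV.

(** * Smooth functions of one variable that vanish on a half line *)

Section flat.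
Context {R : realType}.
Implicit Types (P : {poly R}) (t : R).

(** The functions [P(1/t) e^(-1/t)] for [t > 0], extended by 0. Allowing all
    polynomials [P] makes the class closed under differentiation, so that
    smoothness needs no separate induction on the order. *)
Definition flat P t : R := if 0 < t then P.[t^-1] * expR (- t^-1) else 0.

Definition flat_der P : {poly R} := 'X^2 * (P - P^`()).

(** One term of the exponential series. *)
Lemma pow_expR_le (n : nat) (y : R) : 0 <= y -> y ^+ n * expR (- y) <= n`!%:R.
Proof.
move=> y0; rewrite expRN ler_pdivrMr ?expR_gt0//.
case: n => [|n]; first by rewrite expr0 fact0 mul1r -expR0 ler_expR.
have := expR_ge1Dxn n y0; set z := y ^+ _ => h.
have f0 : 0 < (n.+1)`!%:R :> R by rewrite ltr0n fact_gt0.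
rewrite mulrC -ler_pdivrMr//; apply: le_trans h; lra.
Qed.

(** Each monomial of [P] is beaten by [e^(-1/t)] with two powers of [t] to
    spare; this gives the derivative at the junction point 0. *)
Lemma flat_le_sqr P : exists2 C : R, 0 <= C & forall t, `|flat P t| <= C * t ^+ 2.
Proof.
pose C := \sum_(i < size P) `|P`_i| * (i.+2)`!%:R.
have C0 : 0 <= C by apply: sumr_ge0 => i _; rewrite mulr_ge0.
exists C => // t; rewrite /flat; case: ifPn => [t0|_]; last first.
  by rewrite normr0 mulr_ge0// sqr_ge0.
rewrite -ler_pdivrMr ?exprn_gt0// mulrC -exprVn.
have : 0 <= t^-1 by rewrite invr_ge0 ltW.
move: (t^-1) => y y0.
rewrite horner_coef normrM [X in _ * (_ * X)]ger0_norm ?expR_ge0// mulrA.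
rewrite -{1}(ger0_norm (sqr_ge0 y)) -normrM mulr_sumr.
apply: le_trans (ler_wpM2r (expR_ge0 _) (ler_norm_sum _ _ _)) _.
rewrite mulr_suml; apply: ler_sum => i _.
rewrite mulrCA -exprD normrM -mulrA ler_wpM2l// ger0_norm ?exprn_ge0//.
exact: pow_expR_le.
Qed.

Lemma is_derive_sqr_bound (f : R -> R) (C : R) :
  (forall h, `|f h| <= C * h ^+ 2) -> is_derive (0 : R) (1 : R) f 0.
Proof.
move=> fC.
have f0 : f 0 = 0 by apply/eqP; rewrite -normr_le0 (le_trans (fC 0))// expr0n mulr0.
have C0 : 0 <= C by have := le_trans (normr_ge0 _) (fC 1); rewrite expr1n mulr1.
have H : h^-1 *: (f (h *: 1 + 0) - f 0) @[h --> 0^'] --> 0.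
  apply/cvgr0Pnorm_lt => e e0.
  have C1 : 0 < C + 1 by rewrite ltr_wpDl.
  near=> h.
  have h0 : h != 0 by near: h; exact: nbhs_dnbhs_neq.
  rewrite f0 subr0 addr0 [h *: 1]mulr1 normrZ normrV ?unitfE// mulrC.
  rewrite ltr_pdivrMr ?normr_gt0//; apply: le_lt_trans (fC h) _.
  rewrite -real_normK ?num_real// expr2 mulrA ltr_pM2r ?normr_gt0//.
  apply: (@le_lt_trans _ _ ((C + 1) * `|h|)); first by rewrite ler_wpM2r// lerDl.
  rewrite mulrC -ltr_pdivlMr//.
  near: h; apply: dnbhs0_lt; exact: divr_gt0.
apply: DeriveDef.
  by apply/cvg_ex; exists 0.
exact/cvg_lim.
Unshelve. all: by end_near. Qed.

(** With [y = 1/t], the derivative of [P(y) e^(-y)] in [t] is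
    [y^2 (P - P')(y) e^(-y)]. *)
Lemma is_derive_flat P t : is_derive t (1 : R) (flat P) (flat (flat_der P) t).
Proof.
have [t0|t0|->] := ltgtP t 0.
- rewrite /flat ltNge (ltW t0)/=.
  apply: (@near_eq_is_derive _ _ _ (cst 0)).
  near=> s; rewrite /cst ltNge (_ : s <= 0)//.
  by near: s; exact: lt_le_nbhsl.
- rewrite {2}/flat t0.
  apply: (@near_eq_is_derive _ _ _ (fun s : R => P.[s^-1] * expR (- s^-1))).
    near=> s; rewrite /flat (_ : 0 < s)//.
    by near: s; exact: lt_nbhsr.
  have tn0 : t != 0 by rewrite gt_eqF.
  have dV : is_derive t (1 : R) (fun s : R => s^-1) (- t ^- 2).
    have := @is_deriveV R id t 1 1 tn0 (is_derive_id _ _).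
    by rewrite [_ *: _]mulr1.
  have dP := @is_derive1_comp R (horner P) (fun s : R => s^-1) t _ _ (is_derive_poly _ _) dV.
  have dN : is_derive t (1 : R) (fun s : R => - s^-1) (t ^- 2).
    by have := is_deriveN dV; rewrite opprK.
  have dE := @is_derive1_comp R expR (fun s : R => - s^-1) t _ _ (is_derive_expR _) dN.
  have := is_deriveM dP dE.
  move=> h; apply: is_derive_eq h _.
  rewrite /flat_der hornerM hornerXn hornerD hornerN -![_ *: _]/(_ * _) /= -exprVn.
  ring.
- rewrite {2}/flat ltxx.
  by have [C _ h] := flat_le_sqr P; apply: is_derive_sqr_bound h.
Unshelve. all: by end_near. Qed.

Lemma continuous_flat P : continuous (flat P).
Proof.
move=> t; apply: differentiable_continuous; apply/derivable1_diffP.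
by have [] := is_derive_flat P t.
Qed.

Lemma flat_gt0 t : (0 < flat 1 t) = (0 < t).
Proof.
rewrite /flat; case: ifP => t0; last by rewrite ltxx.
by rewrite hornerC mul1r expR_gt0.
Qed.

Lemma flat_le1 t : 0 <= flat 1 t <= 1.
Proof.
rewrite /flat; case: ifPn => t0; last by rewrite lexx ler01.
by rewrite hornerC mul1r expR_ge0 -expR0 ler_expR oppr_le0 invr_ge0 ltW.
Qed.

End flat.

(** * A class of smooth functions closed under partial derivatives *)

Section elementary.
Context {R : realType} {N : nat}.
Implicit Types (f g phi : 'rV[R]_N -> R).

(** Functions generated from the coordinates by ring operations and
    composition with the flat functions. They are smooth because a partial
    derivative of a generated function is again generated, and they are plentiful
    enough: for [F] in the class, [flat 1 (F x)] is positive exactly where [F]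
    is. *)
Inductive elementary : ('rV[R]_N -> R) -> Prop :=
| elementary_cst c : elementary (fun=> c)
| elementary_coord i : elementary (fun x => x 0 i)
| elementaryD f g : elementary f -> elementary g -> elementary (fun x => f x + g x)
| elementaryM f g : elementary f -> elementary g -> elementary (fun x => f x * g x)
| elementary_flat P f : elementary f -> elementary (fun x => flat P (f x)).

Lemma elementary_sum (I : Type) (s : seq I) (F : I -> 'rV[R]_N -> R) :
  (forall i, elementary (F i)) -> elementary (fun x => \sum_(i <- s) F i x).
Proof.
move=> eF; elim: s => [|i s IH].
  by under eq_fun do rewrite big_nil; exact: elementary_cst.
by under eq_fun do rewrite big_cons; exact: elementaryD.
Qed.

Lemma continuous_elementary f : elementary f -> continuous f.
Proof.
elim=> [c|i|{}f g _ cf _ cg|{}f g _ cf _ cg|P {}f _ cf] x.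
- exact: cst_continuous.
- exact: coord_continuous.
- exact: (continuousD (cf x) (cg x)).
- exact: (continuousM (cf x) (cg x)).
- apply: (continuous_comp (cf x)). exact: continuous_flat.
Qed.

(** The gradient is found by induction together with the chain rule along
    arbitrary curves, which avoids Frechet derivatives: straight lines give the
    partial derivatives, and dilations the derivative in the flow parameter. *)
Lemma elementary_chain f : elementary f -> exists g : 'I_N -> 'rV[R]_N -> R,
  (forall i, elementary (g i)) /\
  forall (gam : R -> 'rV[R]_N) (t : R) (dgam : 'I_N -> R),
    (forall i, is_derive t (1 : R) (fun s => gam s 0 i) (dgam i)) ->
    is_derive t (1 : R) (fun s => f (gam s)) (\sum_i g i (gam t) * dgam i).
Proof.
elim=> [c|i|{}f g _ [df [edf hdf]] _ [dg [edg hdg]]|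
        {}f g ef [df [edf hdf]] eg [dg [edg hdg]]|P {}f ef [df [edf hdf]]].
- exists (fun _ _ => 0); split => [i|gam t dgam _]; first exact: elementary_cst.
  rewrite big1 => [|i _]; last by rewrite mul0r.
  exact: is_derive_cst.
- exists (fun j _ => (i == j)%:R); split => [j|gam t dgam h].
    exact: elementary_cst.
  rewrite (bigD1 i)//= eqxx mul1r big1 ?addr0// => j ji.
  by rewrite eq_sym (negbTE ji) mul0r.
- exists (fun i x => df i x + dg i x); split => [j|gam t dgam h].
    exact: elementaryD.
  under eq_bigr do rewrite mulrDl.
  by rewrite big_split; apply: is_deriveD.
- exists (fun i x => f x * dg i x + g x * df i x); split => [j|gam t dgam h].
    by apply: elementaryD; apply: elementaryM.
  apply: is_derive_eq (is_deriveM (hdf _ _ _ h) (hdg _ _ _ h)) _.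
  rewrite -![_ *: _]/(_ * _) !mulr_sumr -big_split /=.
  by apply: eq_bigr => i _; rewrite mulrDl !mulrA.
- exists (fun i x => flat (flat_der P) (f x) * df i x); split => [j|gam t dgam h].
    by apply: elementaryM => //; exact: elementary_flat.
  have := @is_derive1_comp R (flat P) (fun s => f (gam s)) t _ _ (is_derive_flat _ _) (hdf _ _ _ h).
  rewrite mulr_sumr; under eq_bigr do rewrite mulrA.
  exact.
Qed.

(** Both sides are limits of the same difference quotient. *)
Lemma is_derive_line f (x v : 'rV[R]_N) (d : R) :
  is_derive (0 : R) (1 : R) (fun t => f (t *: v + x)) d -> is_derive x v f d.
Proof.
have E : (fun h : R => h^-1 *: (((fun t => f (t *: v + x)) \o shift 0) (h *: (1 : R))
            - f (0 *: v + x)))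
       = (fun h => h^-1 *: ((f \o shift x) (h *: v) - f x)).
  by apply/funext => h /=; rewrite scale0r add0r addr0 [h *: 1]mulr1.
case=> d1 d2; split.
  by move: d1; rewrite /derivable E.
by move: d2; rewrite /derive E.
Qed.

Lemma is_derive_coord_line (x v : 'rV[R]_N) (t : R) i :
  is_derive t (1 : R) (fun s : R => (s *: v + x) 0 i) (v 0 i).
Proof.
rewrite (_ : (fun s : R => _) = (fun s : R => s * v 0 i + x 0 i)); last first.
  by apply/funext => s; rewrite !mxE.
have h := is_deriveD (is_deriveM (is_derive_id t (1 : R)) (is_derive_cst (v 0 i) t (1 : R)))
  (is_derive_cst (x 0 i) t (1 : R)).
apply: is_derive_eq h _.
by rewrite -![_ *: _]/(_ * _) mulr0 add0r addr0 mulr1.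
Qed.

Lemma elementary_partial f : elementary f ->
  [/\ forall i, elementary (partial i f),
     forall i x, derivable f x (delta_mx 0 i) &
     forall (gam : R -> 'rV[R]_N) (t : R) (dgam : 'I_N -> R),
       (forall i, is_derive t (1 : R) (fun s => gam s 0 i) (dgam i)) ->
       is_derive t (1 : R) (fun s => f (gam s)) (\sum_i partial i f (gam t) * dgam i)].
Proof.
move=> /elementary_chain[g [eg hg]].
have H i x : is_derive x (delta_mx 0 i) f (g i x).
  apply: is_derive_line.
  have := hg (fun t => t *: delta_mx 0 i + x) 0 (fun j => (delta_mx 0 i : 'rV[R]_N) 0 j)
    (fun j => is_derive_coord_line _ _ _ _).
  rewrite scale0r add0r (bigD1 i)//= big1 => [|j ji]; last first.
    by rewrite mxE (negbTE ji) andbF mulr0.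
  by rewrite mxE !eqxx mulr1 addr0.
have E i : partial i f = g i.
  by apply/funext => x; rewrite /partial; apply: derive_val.
split=> [i|i x|gam t dgam h]; first by rewrite E.
- by have [] := H i x.
- under eq_bigr do rewrite E; exact: hg.
Qed.

Lemma smooth_elementary f : elementary f -> smooth f.
Proof.
move=> ef s; have es : elementary (iter_partial s f).
  by elim: s => //= i s /elementary_partial[].
split; first exact: continuous_elementary.
by move=> i x; have [_ + _] := elementary_partial es; apply.
Qed.

Definition norm2 (x : 'rV[R]_N) : R := \sum_i x 0 i ^+ 2.

Lemma norm_rV_leP (x : 'rV[R]_N) (M : R) : 0 <= M -> `|x| <= M <-> cube M x.
Proof.
move=> M0; rewrite /Num.norm/= mx_normrE; split=> [h i|h].
  exact: le_trans (@le_bigmax _ _ _ 0 (fun ij : 'I_1 * 'I_N => `|x ij.1 ij.2|) (0, i)) h.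
by apply/bigmax_leP; split=> // -[j i] _; rewrite ord1; exact: h.
Qed.

Lemma closed_cube (M : R) : closed (cube M : set 'rV[R]_N).
Proof.
rewrite (_ : cube M = \bigcap_(i in [set: 'I_N]) [set x | `|x 0 i| <= M]).
  apply: closed_bigI => i _.
  apply: (@closed_comp _ _ (fun x : 'rV[R]_N => `|x 0 i|) [set t | t <= M]).
    move=> x _; apply: continuous_comp; first exact: coord_continuous.
    exact: norm_continuous.
  exact: closed_le.
by apply/seteqP; split=> x /= h i => [_|]; exact: h.
Qed.

Lemma compact_in_cube (M : R) (A : set 'rV[R]_N) : closed A -> A `<=` cube M ->
  compact A.
Proof.
move=> cA AM; apply: bounded_closed_compact => //.
exists `|M|; split=> [|B MB x]; first exact: num_real.
move=> /AM Mx; apply/(norm_rV_leP _ (le_trans (normr_ge0 M) (ltW MB))) => i.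
by apply: le_trans (Mx i) _; apply: le_trans (ler_norm _) (ltW MB).
Qed.

Lemma compact_cube (M : R) : compact (cube M : set 'rV[R]_N).
Proof. by apply: (@compact_in_cube M); first exact: closed_cube. Qed.

(** The source of all test functions used below. *)
Lemma test_function_elementary f (M : R) : elementary f ->
  (forall x, f x != 0 -> cube M x) -> test_function f.
Proof.
move=> ef fM; split; first exact: smooth_elementary.
apply: (@compact_in_cube M); first exact: closed_closure.
have sM : [set x | f x != 0] `<=` cube M by [].
by move=> x /(closureS sM); rewrite -(closure_id (cube M)).1//; exact: closed_cube.
Qed.

End elementary.

(** * Integrable and square integrable functions on the Euclidean space *)

Section integration.
Context {R : realType} {N : nat}.
Implicit Types (f g : 'rV[R]_N -> R).

Definition integrable_rV f : Prop := (leb_rV R N).-integrable setT (EFin \o f).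

(** The integral as a real number; it represents the extended real integral
    when the function is integrable. *)
Definition intg f : R := (\int[leb_rV R N]_x f x)%R.

Lemma measurable_integrable_rV f : integrable_rV f -> measurable_fun setT f.
Proof. by move=> /integrableP[/measurable_EFinP]. Qed.

Lemma le_integrable_rV g f : measurable_fun setT f -> (forall x, `|f x| <= g x) ->
  integrable_rV g -> integrable_rV f.
Proof.
move=> mf fg; apply: le_integrable => //; first exact/measurable_EFinP.
by move=> x _ /=; rewrite lee_fin (le_trans (fg x))// ler_norm.
Qed.

Lemma integrable_rVD f g : integrable_rV f -> integrable_rV g -> integrable_rV (fun x => f x + g x).
Proof. by move=> sf sg; have := integrableD measurableT sf sg. Qed.

Lemma integrable_rVZ c f : integrable_rV f -> integrable_rV (fun x => c * f x).
Proof. by move=> sf; have := integrableZl measurableT c sf. Qed.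

Lemma integrable_rV_sum (I : Type) (s : seq I) (F : I -> 'rV[R]_N -> R) :
  (forall i, integrable_rV (F i)) -> integrable_rV (fun x => \sum_(i <- s) F i x).
Proof.
move=> sF; elim: s => [|i s IH].
  under eq_fun do rewrite big_nil; exact: integrable0.
under eq_fun do rewrite big_cons; exact: integrable_rVD.
Qed.

Lemma intgD f g : integrable_rV f -> integrable_rV g ->
  intg (fun x => f x + g x) = intg f + intg g.
Proof. exact: RintegralD. Qed.

Lemma intgZ c f : integrable_rV f -> intg (fun x => c * f x) = c * intg f.
Proof. by move=> sf; exact: RintegralZl. Qed.

Lemma intg_sum (I : Type) (s : seq I) (F : I -> 'rV[R]_N -> R) :
  (forall i, integrable_rV (F i)) ->
  intg (fun x => \sum_(i <- s) F i x) = \sum_(i <- s) intg (F i).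
Proof.
move=> sF; elim: s => [|i s IH].
  rewrite big_nil; under eq_fun do rewrite big_nil.
  by rewrite /intg /Rintegral integral0.
rewrite big_cons -IH -intgD//; last exact: integrable_rV_sum.
by congr intg; apply/funext => x; rewrite big_cons.
Qed.

Lemma le_intg f g : integrable_rV f -> integrable_rV g -> (forall x, f x <= g x) ->
  intg f <= intg g.
Proof. by move=> sf sg fg; apply: le_Rintegral => // x _; exact: fg. Qed.

Lemma intg_ge0 f : (forall x, 0 <= f x) -> 0 <= intg f.
Proof. by move=> f0; apply: Rintegral_ge0. Qed.

Lemma EFin_intg f : integrable_rV f -> (intg f)%:E = (\int[leb_rV R N]_x (f x)%:E)%E.
Proof. by move=> sf; rewrite /intg /Rintegral fineK// integrable_fin_num. Qed.

Lemma integrable_rV_ge0 f : measurable_fun setT f -> (forall x, 0 <= f x) ->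
  (\int[leb_rV R N]_x (f x)%:E < +oo)%E -> integrable_rV f.
Proof.
move=> mf f0 foo; apply/integrableP; split; first exact/measurable_EFinP.
by under eq_integral do rewrite /= ger0_norm//.
Qed.

Lemma integrable_rV_affine (b : 'rV[R]_N) (c : R) f : 0 < c -> integrable_rV f ->
  integrable_rV (fun x => f (b + c *: x)).
Proof.
move=> c0 sf; have mf := measurable_integrable_rV sf.
have mA := measurable_affine b c.
have mfA : measurable_fun setT (fun x : 'rV[R]_N => f (b + c *: x)).
  exact: (measurableT_comp mf).
apply/integrableP; split; first exact/measurable_EFinP.
rewrite (@ge0_integral_affine R N b c (fun x => `|(f x)%:E|%E))//; last first.
  by apply: measurableT_comp => //; exact/measurable_EFinP.
by rewrite lte_mul_pinfty// ?lee_fin ?invr_ge0 ?exprn_ge0 ?ltW//; case/integrableP: sf.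
Qed.

Lemma intg_affine (b : 'rV[R]_N) (c : R) f : 0 < c -> integrable_rV f ->
  intg (fun x => f (b + c *: x)) = c ^- N * intg f.
Proof.
move=> c0 sf; apply: EFin_inj; rewrite EFinM !EFin_intg//; last exact: integrable_rV_affine.
rewrite (@integral_affine R N b c (EFin \o f))//.
by apply/measurable_EFinP; exact: measurable_integrable_rV.
Qed.

(** Membership in L2, in the form in which it is used. *)
Definition sqint f : Prop := measurable_fun setT f /\ integrable_rV (fun x => f x ^+ 2).

Lemma L2_sqint f : L2 f -> sqint f.
Proof.
move=> Lf; split; last exact: Lfun2_integrable_sqr.
by move: Lf; rewrite /L2 => /sub_Lfun_mfun; rewrite inE.
Qed.

Lemma sqint_L2 f : sqint f -> L2 f.
Proof.
move=> [mf sf]; rewrite /L2 inE; apply/andP; split; rewrite inE/=; first exact: mf.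
rewrite /finite_norm unlock /=.
rewrite poweR_lty//.
case/integrableP: sf => _; apply: le_lt_trans.
rewrite le_eqVlt; apply/orP; left; apply/eqP.
by apply: eq_integral => x _ /=; rewrite powR_mulrn// normrX.
Qed.

(** The difference of the two sides is [t (|x| - |y|/t)^2]. *)
Lemma young (x y t : R) : 0 < t -> 2 * `|x * y| <= t * x ^+ 2 + t^-1 * y ^+ 2.
Proof.
move=> t0; rewrite -subr_ge0 normrM -(real_normK (num_real x)) -(real_normK (num_real y)).
move: `|x| `|y| => {}x {}y.
rewrite (_ : _ - _ = t * (x - t^-1 * y) ^+ 2); last by field; rewrite gt_eqF.
by rewrite mulr_ge0 ?sqr_ge0// ltW.
Qed.

Lemma sqintM f g : sqint f -> sqint g -> integrable_rV (fun x => f x * g x).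
Proof.
move=> [mf sf] [mg sg].
apply: (@le_integrable_rV (fun x => f x ^+ 2 + g x ^+ 2)).
- exact: measurable_funM.
- move=> x; have := @young (f x) (g x) 1 ltr01; rewrite invr1 !mul1r.
  have := normr_ge0 (f x * g x); lra.
- exact: integrable_rVD.
Qed.

Lemma integrable_rV_cube (M : R) : integrable_rV (\1_(cube M)).
Proof.
apply: integrable_rV_ge0.
- apply: measurable_indic; exact: measurable_cube.
- by move=> x.
- by rewrite integral_indic ?setIT//; [exact: lt_leb_cube|exact: measurable_cube].
Qed.

Lemma sqint_cube_bounded f (M C : R) : measurable_fun setT f ->
  (forall x, `|f x| <= C * \1_(cube M) x) -> sqint f.
Proof.
move=> mf fC; split=> //.
apply: (@le_integrable_rV (fun x => C ^+ 2 * \1_(cube M) x)).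
- exact: measurable_funX.
- move=> x; rewrite normrX; apply: (@le_trans _ _ ((C * \1_(cube M) x) ^+ 2)).
    by apply: lerXn2r; rewrite ?nnegrE//; exact: le_trans (normr_ge0 _) (fC x).
  by rewrite exprMn indicE; case: (_ \in _); rewrite /= ?expr1n ?expr0n.
- exact/integrable_rVZ/integrable_rV_cube.
Qed.

Lemma integrable_rV_cube_bounded f (M C : R) : measurable_fun setT f ->
  (forall x, `|f x| <= C * \1_(cube M) x) -> integrable_rV f.
Proof. by move=> mf /le_integrable_rV; apply => //; exact/integrable_rVZ/integrable_rV_cube. Qed.

(** A compactly supported continuous function is dominated by a multiple of
    the indicator of a cube, the standard dominating function below. *)
Lemma continuous_cube_bounded f (M : R) : continuous f ->
  (forall x, f x != 0 -> cube M x) ->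
  exists2 C, 0 <= C & forall x, `|f x| <= C * \1_(cube M) x.
Proof.
move=> cf fM.
have : compact (f @` cube M).
  apply: continuous_compact; last exact: compact_cube.
  exact: continuous_subspaceT.
move=> /compact_bounded /ex_strict_bound_gt0[C C0 hC].
exists C => [|x]; first exact: ltW.
rewrite indicE; case: (boolP (x \in cube M)) => [|/negP] Mx.
  by rewrite mulr1 ltW//; apply: hC; exists x => //; rewrite inE in Mx.
rewrite mulr0; have [->|/fM Mx'] := eqVneq (f x) 0; first by rewrite normr0.
by case: Mx; rewrite inE.
Qed.

(** Differentiation under the integral sign. All its uses concern a smooth
    flow acting on a function of bounded support, so an interval of radius 1 is
    enough. *)
Lemma is_derive_intg (f df : R -> 'rV[R]_N -> R) (a : R) (G : 'rV[R]_N -> R) :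
  (forall t x, `|t - a| < 1 -> is_derive t (1 : R) (f ^~ x) (df t x)) ->
  (forall t, `|t - a| < 1 -> integrable_rV (f t)) ->
  (forall t x, `|t - a| < 1 -> `|df t x| <= G x) ->
  integrable_rV G ->
  is_derive a (1 : R) (fun t => intg (f t)) (intg (df a)).
Proof.
move=> hd sf dG sG.
have I1 t : t \in `](a - 1), (a + 1)[ -> `|t - a| < 1 by rewrite in_itv/= ltr_distl.
have aI : `](a - 1), (a + 1)[%classic a by rewrite /= in_itv/= ltrDl ltrBlDr ltrDl ltr01.
have E t x : `|t - a| < 1 -> partial1of2 f t x = df t x.
  by move=> /hd h; rewrite partial1of2E; apply: derive_val.
have G0 x : 0 <= G x by apply: le_trans (dG a x _); rewrite ?normr_ge0// subrr normr0.
have dG' t x : `](a - 1), (a + 1)[%classic t -> setT x -> `|partial1of2 f t x| <= G x.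
  by move=> /I1 ta _; rewrite E// dG.
have sf' t : `](a - 1), (a + 1)[%classic t -> (leb_rV R N).-integrable setT (EFin \o f t).
  by move=> /I1; exact: sf.
have hd' t x : `](a - 1), (a + 1)[%classic t -> setT x -> derivable (f ^~ x) t 1.
  by move=> /I1 /hd h _; have [] := h x.
have D1 := @derivable_under_integral R _ _ (leb_rV R N) f setT measurableT a _ _ aI
  sf' hd' G G0 sG dG'.
have D2 := @differentiation_under_integral R _ _ (leb_rV R N) f setT measurableT a _ _ aI
  sf' hd' G G0 sG dG'.
apply: DeriveDef; first exact: D1.
rewrite -derive1E; rewrite [LHS]D2; apply: eq_Rintegral => x _.
by rewrite E// subrr normr0.
Qed.

End integration.

(** * The dual form of the Hardy inequality, for test functions *)

Section dual.
Context {R : realType} {N : nat}.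
Implicit Types (f phi u : 'rV[R]_N -> R).

Lemma elementary_affine f (b : 'rV[R]_N) (c : R) : elementary f ->
  elementary (fun x => f (b + c *: x)).
Proof.
elim=> [d|i|{}f g _ ef _ eg|{}f g _ ef _ eg|P {}f _ ef].
- exact: elementary_cst.
- under eq_fun do rewrite !mxE.
  apply: elementaryD; first exact: elementary_cst.
  by apply: elementaryM; [exact: elementary_cst|exact: elementary_coord].
- exact: elementaryD ef eg.
- exact: elementaryM ef eg.
- exact: elementary_flat ef.
Qed.

(** Outside the cube, which is closed, the function vanishes in a
    neighbourhood. *)
Lemma partial_cube f (M : R) (i : 'I_N) : (forall x, f x != 0 -> cube M x) ->
  forall x, partial i f x != 0 -> cube M x.
Proof.
move=> fM x; apply: contra_neqP => nMx.
rewrite /partial; apply: derive_val.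
apply: (@near_eq_is_derive _ _ _ (cst (0 : R))).
have : open (~` (cube M : set 'rV[R]_N)) by apply: closed_openC; exact: closed_cube.
move=> oM; have nM := open_nbhs_nbhs (conj oM nMx); near=> y.
have nMy : ~ cube M y by near: y.
by apply/esym/eqP; apply: contra_notT nMy => /fM.
Unshelve. all: by end_near. Qed.

Lemma norm2_ge0 (x : 'rV[R]_N) : 0 <= norm2 x.
Proof. by apply: sumr_ge0 => i _; exact: sqr_ge0. Qed.

Lemma enorm_sqr (x : 'rV[R]_N) : enorm x ^+ 2 = norm2 x.
Proof. by rewrite /enorm sqr_sqrtr// norm2_ge0. Qed.

Lemma is_derive_coord (x v : 'rV[R]_N) (i : 'I_N) :
  is_derive x v (fun y : 'rV[R]_N => y 0 i) (v 0 i).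
Proof. by apply: is_derive_line; exact: is_derive_coord_line. Qed.

Lemma elementary_is_derive f (x : 'rV[R]_N) i : elementary f ->
  is_derive x (delta_mx 0 i) f (partial i f x).
Proof.
by move=> /elementary_partial[_ + _] => /(_ i x) h; apply: DeriveDef.
Qed.

Lemma elementary_sqint f (M : R) : elementary f -> (forall x, f x != 0 -> cube M x) ->
  sqint f.
Proof.
move=> ef fM; have cf := continuous_elementary ef.
have [C _ hC] := continuous_cube_bounded cf fM.
by apply: sqint_cube_bounded hC; exact: continuous_measurable_rV.
Qed.

Lemma is_derive_expRN (k t : R) :
  is_derive t (1 : R) (fun s : R => expR (- (k * s))) (- k * expR (- (k * t))).
Proof.
have h := is_deriveN (is_deriveZ k (is_derive_id t (1 : R))).
have h' := @is_derive1_comp R expR _ t _ _ (is_derive_expR _) h.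
by apply: is_derive_eq h' _; rewrite -![_ *: _]/(_ * _) mulr1 mulrC.
Qed.

Section dilation.
Variables (a : 'rV[R]_N) (phi : 'rV[R]_N -> R) (M : R).
Hypotheses (ephi : elementary phi) (phiM : forall x, phi x != 0 -> cube M x).

Let dil (t : R) (x : 'rV[R]_N) : 'rV[R]_N := (a - expR (- t) *: a) + expR (- t) *: x.

(** The mass-preserving spreading of [phi] by the dilation of ratio [e^t]
    about [a]. *)
Definition dilate (t : R) (x : 'rV[R]_N) : R := expR (- (N%:R * t)) * phi (dil t x).

Let div_ (x : 'rV[R]_N) : R := N%:R * phi x + \sum_i partial i phi x * (x 0 i - a 0 i).

Let dilE t x i : dil t x 0 i = a 0 i + expR (- t) * (x 0 i - a 0 i).
Proof. by rewrite !mxE; ring. Qed.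

Lemma elementary_dilate t : elementary (dilate t).
Proof.
apply: elementaryM; first exact: elementary_cst.
exact: elementary_affine.
Qed.

Let elementary_div : elementary div_.
Proof.
apply: elementaryD.
  by apply: elementaryM => //; exact: elementary_cst.
apply: elementary_sum => i; apply: elementaryM.
  by have [+ _ _] := elementary_partial ephi; apply.
apply: elementaryD; first exact: elementary_coord.
exact: elementary_cst.
Qed.

Let div_cube x : div_ x != 0 -> cube M x.
Proof.
apply: contra_neqP => nMx; rewrite /div_.
have p0 f : (forall x, f x != 0 -> cube M x) -> f x = 0.
  by move=> fM; apply/eqP; apply: contra_notT nMx => /fM.
rewrite p0// mulr0 add0r big1// => i _.
by rewrite p0 ?mul0r// => y; exact: partial_cube.
Qed.

Let Mt t : R := `|a| + expR (t + 1) * (`|M| + `|a|).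

Let dil_cube t0 t x : `|t - t0| < 1 -> cube M (dil t x) -> cube (Mt t0) x.
Proof.
move=> tt0 Mx i; have := Mx i; rewrite dilE => h.
have ai : `|a 0 i| <= `|a| by have /norm_rV_leP -/(_ (normr_ge0 a)) := lexx `|a|; apply.
have e0 := expR_gt0 t.
have -> : x 0 i = a 0 i + expR t * ((a 0 i + expR (- t) * (x 0 i - a 0 i)) - a 0 i).
  by rewrite addrAC subrr add0r mulrA -expRD subrr expR0 mul1r addrC subrK.
apply: le_trans (ler_normD _ _) _; apply: lerD => //.
rewrite normrM gtr0_norm//; apply: ler_pM; rewrite ?normr_ge0 ?expR_ge0//.
  by rewrite ler_expR; move: tt0; rewrite ltr_distl => /andP[_ /ltW].
apply: le_trans (ler_normB _ _) _; apply: lerD => //.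
exact: le_trans h (ler_norm _).
Qed.

Let theta t i (x : 'rV[R]_N) : R := (x 0 i - a 0 i) * dilate t x.

Lemma elementary_theta t i : elementary (theta t i).
Proof.
apply: elementaryM; last exact: elementary_dilate.
apply: elementaryD; first exact: elementary_coord.
exact: elementary_cst.
Qed.

Let partial_dilate t i x :
  partial i (dilate t) x = expR (- (N%:R * t)) * (partial i phi (dil t x) * expR (- t)).
Proof.
rewrite {1}/partial; apply: derive_val; apply: is_derive_line.
have [_ _ chain] := elementary_partial ephi.
have h := chain (fun s => dil t (s *: delta_mx 0 i + x)) 0
  (fun j => expR (- t) * (delta_mx 0 i : 'rV[R]_N) 0 j).
have {}h := is_deriveZ (expR (- (N%:R * t))) (h _).
apply: is_derive_eq; first apply: h.
  move=> j; under eq_fun do rewrite dilE.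
  have h1 := is_deriveB (is_derive_coord_line x (delta_mx 0 i) 0 j) (is_derive_cst (a 0 j) (0 : R) (1 : R)).
  have := is_deriveD (is_derive_cst (a 0 j) (0 : R) (1 : R)) (is_deriveZ (expR (- t)) h1).
  by rewrite add0r subr0.
rewrite -![_ *: _]/(_ * _); congr (_ * _).
rewrite (bigD1 i)//= big1 ?addr0 => [|j ji]; last first.
  by rewrite mxE (negbTE ji) andbF !mulr0.
by rewrite mxE !eqxx mulr1 scale0r add0r.
Qed.

Let partial_theta t i x :
  partial i (theta t i) x = dilate t x + (x 0 i - a 0 i) * partial i (dilate t) x.
Proof.
rewrite {1}/partial; apply: derive_val.
have h1 := is_deriveB (is_derive_coord x (delta_mx 0 i) i) (is_derive_cst (a 0 i) x (delta_mx 0 i)).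
have h2 := is_deriveM h1 (elementary_is_derive x i (elementary_dilate t)).
apply: is_derive_eq h2 _.
by rewrite -![_ *: _]/(_ * _) mxE !eqxx subr0 mulr1 addrC.
Qed.

(** The continuity equation of the dilation flow: with
    [theta_i = (x_i - a_i) dilate t x], the derivative of [dilate] in [t] is minus
    the divergence of [theta]. *)
Lemma is_derive_dilate t x :
  is_derive t (1 : R) (dilate ^~ x) (- \sum_i partial i (theta t i) x).
Proof.
have [_ _ chain] := elementary_partial ephi.
have dE k := is_derive_expRN k t.
have h := chain (fun s => dil s x) t (fun j => - expR (- t) * (x 0 j - a 0 j)).
have {}h := is_deriveM (dE N%:R) (h _).
apply: is_derive_eq; first apply: h.
  move=> j; under eq_fun do rewrite dilE mulrC.
  have := is_deriveD (is_derive_cst (a 0 j) t (1 : R)) (is_deriveZ (x 0 j - a 0 j) (dE 1)).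
  under eq_fun do rewrite mul1r.
  move=> h'; apply: is_derive_eq h' _.
  by rewrite add0r -![_ *: _]/(_ * _) mul1r; ring.
rewrite (eq_bigr _ (fun i _ => partial_theta t i x)) big_split /= sumr_const card_ord.
rewrite -![_ *: _]/(_ * _) opprD addrC; congr (_ + _).
  by rewrite /dilate -mulr_natl; ring.
rewrite mulr_sumr -sumrN; apply: eq_bigr => i _.
by rewrite partial_dilate; ring.
Qed.

Let sum_partial_theta t x :
  \sum_i partial i (theta t i) x = expR (- (N%:R * t)) * div_ (dil t x).
Proof.
rewrite (eq_bigr _ (fun i _ => partial_theta t i x)) big_split /= sumr_const card_ord.
rewrite /div_ mulrDr; congr (_ + _).
  by rewrite /dilate -mulr_natl; ring.
rewrite mulr_sumr; apply: eq_bigr => i _.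
by rewrite partial_dilate dilE; ring.
Qed.

Let cube_le t0 t (h : 'rV[R]_N -> R) C x : `|t - t0| < 1 -> 0 <= C ->
  (forall y, `|h y| <= C * \1_(cube M) y) ->
  `|expR (- (N%:R * t)) * h (dil t x)| <= expR (N%:R * (1 - t0)) * C * \1_(cube (Mt t0)) x.
Proof.
move=> tt0 C0 hC.
rewrite normrM gtr0_norm ?expR_gt0// -mulrA.
apply: ler_pM; rewrite ?normr_ge0 ?expR_ge0//.
  rewrite ler_expR -mulrN ler_wpM2l//; move: tt0; rewrite ltr_distl => /andP[]; lra.
apply: le_trans (hC _) _; apply: ler_wpM2l => //; rewrite !indicE.
case: (boolP (dil t x \in cube M)) => //.
by rewrite inE => /(dil_cube tt0) Mx; rewrite mem_set.
Qed.

Let dilate_cube t x : dilate t x != 0 -> cube (Mt t) x.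
Proof.
rewrite /dilate mulf_eq0 negb_or => /andP[_ /phiM]; apply: dil_cube.
by rewrite subrr normr0.
Qed.

Let theta_cube t i x : theta t i x != 0 -> cube (Mt t) x.
Proof. by rewrite /theta mulf_eq0 negb_or => /andP[_]; exact: dilate_cube. Qed.

Variables (u : 'rV[R]_N -> R) (g : 'rV[R]_N -> 'rV[R]_N).
Hypothesis ug : H1 u g.

Let su : sqint u. Proof. by case: ug => /L2_sqint. Qed.
Let sg i : sqint (fun x => g x 0 i). Proof. by case: ug => _ /(_ i) /L2_sqint. Qed.

Let sdilate t : sqint (dilate t).
Proof. exact: (elementary_sqint (elementary_dilate t) (@dilate_cube t)). Qed.

Let stheta t i : sqint (theta t i).
Proof. exact: (elementary_sqint (elementary_theta t i) (@theta_cube t i)). Qed.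

Let spartial_theta t i : sqint (partial i (theta t i)).
Proof.
apply: (@elementary_sqint _ (Mt t)); last exact: (partial_cube (@theta_cube t i)).
by have [+ _ _] := elementary_partial (elementary_theta t i); apply.
Qed.

(** The continuity equation integrated against [u]; the divergence is moved
    to [u] by the definition of the weak gradient, [theta] being a vector of test
    functions. *)
Lemma is_derive_intg_dilate t :
  is_derive t (1 : R) (fun s => intg (fun x => u x * dilate s x))
    (intg (fun x => \sum_i g x 0 i * theta t i x)).
Proof.
have [C C0 hC] := continuous_cube_bounded (continuous_elementary elementary_div) div_cube.
have h := @is_derive_intg R N (fun s x => u x * dilate s x)
  (fun s x => u x * - \sum_i partial i (theta s i) x) t
  (fun x => `|u x| * (expR (N%:R * (1 - t)) * C * \1_(cube (Mt t)) x)).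
apply: is_derive_eq; first apply: h.
- by move=> s x _; have := is_deriveZ (u x) (is_derive_dilate s x).
- by move=> s _; exact: sqintM.
- move=> s x st; rewrite normrM ler_wpM2l// normrN sum_partial_theta.
  exact: cube_le.
- apply: sqintM.
    split; first exact: measurableT_comp su.1.
    by under eq_fun do rewrite real_normK ?num_real//; exact: su.2.
  apply: (@sqint_cube_bounded _ _ _ (Mt t) (expR (N%:R * (1 - t)) * C)).
    apply: measurable_funM => //; apply: measurable_indic; exact: measurable_cube.
  by move=> x; rewrite ger0_norm// mulr_ge0// mulr_ge0// expR_ge0.
under eq_fun do rewrite mulrN -mulN1r mulr_sumr.
rewrite intgZ; last by apply: integrable_rV_sum => i; exact: sqintM.
rewrite !intg_sum; try by move=> i; exact: sqintM.
rewrite mulN1r -sumrN; apply: eq_bigr => i _.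
apply: EFin_inj; rewrite EFinN !EFin_intg; try exact: sqintM.
have [_ _ /(_ i (theta t i)) ->] := ug; first by rewrite oppeK.
exact: test_function_elementary (elementary_theta t i) (@theta_cube t i).
Qed.

Let G := intg (fun x => norm2 (g x)).
Let X := intg (fun x => norm2 (x - a) * phi x ^+ 2).
Let kap : R := (N%:R - 2) / 2.
Let F (t : R) := intg (fun x => u x * dilate t x).
Let F' (t : R) := intg (fun x => \sum_i g x 0 i * theta t i x).

Let sX : integrable_rV (fun x => norm2 (x - a) * phi x ^+ 2).
Proof.
pose h i (x : 'rV[R]_N) := (x 0 i - a 0 i) * phi x.
have eh i : sqint (h i).
  apply: (@elementary_sqint _ M).
    apply: elementaryM => //; apply: elementaryD; first exact: elementary_coord.
    exact: elementary_cst.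
  by move=> x; rewrite /h mulf_eq0 negb_or => /andP[_]; exact: phiM.
have -> : (fun x => norm2 (x - a) * phi x ^+ 2) = fun x => \sum_i h i x ^+ 2.
  apply/funext => x; rewrite /norm2 mulr_suml; apply: eq_bigr => i _.
  by rewrite !mxE exprMn.
by apply: integrable_rV_sum => i; exact: (eh i).2.
Qed.

(** The scaling that decides everything: [theta] carries [e^(-Nt)] from
    [dilate] and [e^t] from [x - a]; squared and integrated, with [e^(Nt)] from the
    change of variables, this leaves [e^(-(N-2)t)]. *)
Let sum_theta2 t : intg (fun x => \sum_i theta t i x ^+ 2) = expR (- (2 * kap * t)) * X.
Proof.
have -> : (fun x => \sum_i theta t i x ^+ 2) = fun x =>
    expR (- (2 * N%:R * t) + 2 * t) * (norm2 (dil t x - a) * phi (dil t x) ^+ 2).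
  apply/funext => x; rewrite /norm2 mulr_suml mulr_sumr; apply: eq_bigr => i _.
  rewrite mxE dilE /theta /dilate mxE !exprMn.
  have -> : expR (- (N%:R * t)) ^+ 2 = expR (- (2 * N%:R * t)).
    by rewrite -expRM_natl; congr expR; ring.
  rewrite expRD (_ : expR (2 * t) = expR t ^+ 2); last by rewrite -expRM_natl.
  have -> : a 0 i + expR (- t) * (x 0 i - a 0 i) - a 0 i = expR (- t) * (x 0 i - a 0 i).
    by rewrite addrAC subrr add0r.
  rewrite exprMn; have e1 : expR t ^+ 2 * expR (- t) ^+ 2 = 1.
    by rewrite -exprMn -expRD subrr expR0 expr1n.
  rewrite -[LHS]mul1r -e1; ring.
have h := @intg_affine R N (a - expR (- t) *: a) _ _ (expR_gt0 (- t)) sX.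
rewrite intgZ; last exact: (integrable_rV_affine (a - expR (- t) *: a) (expR_gt0 (- t)) sX).
rewrite [X in _ * X]h -/X mulrA; congr (_ * _).
rewrite expRN exprVn invrK -expRM_natl -expRD; congr expR; rewrite /kap; by field.
Qed.

Hypothesis hN : (3 <= N)%N.

Let kap0 : 0 < kap.
Proof.
by rewrite divr_gt0// subr_gt0 ltr_nat.
Qed.

Let sG : integrable_rV (fun x => norm2 (g x)).
Proof. by apply: integrable_rV_sum => i; exact: (sg i).2. Qed.

(** Young's inequality with parameter [e^(-kap t)/kap], which balances the
    decay of the two terms and makes the final constant optimal. *)
Let sum_theta_le t : - (2 * F' t) <= expR (- (kap * t)) * (kap^-1 * G + kap * X).
Proof.
(* The Young parameter for which both terms decay like e^(-kap t). *)
pose s := expR (- (kap * t)) / kap.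
have s0 : 0 < s by rewrite divr_gt0// expR_gt0.
have i1 : integrable_rV (fun x => \sum_i g x 0 i * theta t i x).
  by apply: integrable_rV_sum => i; exact: sqintM.
have i2 : integrable_rV (fun x => \sum_i theta t i x ^+ 2).
  by apply: integrable_rV_sum => i; exact: (stheta t i).2.
rewrite -mulNr -intgZ//.
apply: (@le_trans _ _ (intg (fun x => s * norm2 (g x) + s^-1 * \sum_i theta t i x ^+ 2))).
  apply: le_intg.
  - exact: integrable_rVZ.
  - by apply: integrable_rVD; apply: integrable_rVZ.
  move=> x; rewrite /norm2 !mulr_sumr -big_split /=; apply: ler_sum => i _.
  apply: le_trans (young (g x 0 i) (theta t i x) s0).
  by apply: le_trans (ler_norm _) _; rewrite normrM normrN [`|2|]ger0_norm.
rewrite intgD ?intgZ// ?sum_theta2; try exact: integrable_rVZ.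
rewrite (_ : expR (- (2 * kap * t)) = expR (- (kap * t)) ^+ 2); last first.
  by rewrite -expRM_natl; congr expR; ring.
rewrite -/G /s le_eqVlt; apply/orP; left; apply/eqP.
by field; rewrite !gt_eqF ?expR_gt0.
Qed.

(** Here [u] itself, and not only its gradient, has to be square integrable. *)
Let F_infty t : 2 * F t <= expR (- (N%:R / 2 * t)) *
   (intg (fun x => u x ^+ 2) + intg (fun x => phi x ^+ 2)).
Proof.
pose s := expR (- (N%:R / 2 * t)).
have s0 : 0 < s by rewrite expR_gt0.
have sphi : sqint phi by exact: elementary_sqint ephi phiM.
rewrite -intgZ; last exact: sqintM.
apply: (@le_trans _ _ (intg (fun x => s * u x ^+ 2 + s^-1 * dilate t x ^+ 2))).
  apply: le_intg.
  - by apply: integrable_rVZ; exact: sqintM.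
  - by apply: integrable_rVD; apply: integrable_rVZ; [exact: su.2|exact: (sdilate t).2].
  move=> x; apply: le_trans (young _ _ s0).
  by apply: le_trans (ler_norm _) _; rewrite normrM [`|2|]ger0_norm.
have h := @intg_affine R N (a - expR (- t) *: a) _ _ (expR_gt0 (- t)) sphi.2.
have E : intg (fun x => dilate t x ^+ 2) = s ^+ 2 * intg (fun x => phi x ^+ 2).
  have -> : (fun x => dilate t x ^+ 2) =
     fun x => expR (- (2 * N%:R * t)) * phi (dil t x) ^+ 2.
    apply/funext => x; rewrite /dilate exprMn -expRM_natl; congr (expR _ * _); ring.
  rewrite intgZ; last exact: (integrable_rV_affine (a - expR (- t) *: a) (expR_gt0 (- t)) sphi.2).
  rewrite [X in _ * X]h mulrA; congr (_ * _).
  rewrite (expRN t) exprVn invrK -expRM_natl -expRD /s -expRM_natl; congr expR; by field.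
rewrite intgD ?intgZ ?E; try (exact: su.2 || exact: (sdilate t).2 ||
  (apply: integrable_rVZ; exact: su.2) || (apply: integrable_rVZ; exact: (sdilate t).2)).
by rewrite mulrDr expr2 !mulrA mulVf ?gt_eqF// mul1r.
Qed.

(** The derivative of [F t = int u (dilate t)] is at least
    [- B/2 e^(-kap t)] with [kap = (N-2)/2], so [H t = 2 F t - B/kap e^(-kap t)] is
    nondecreasing and [2 F 0 <= B/kap + 2 F T] for all [T]. As [F T] tends to 0,
    [2 F 0 <= B/kap], which is the claim. *)
Lemma dual_hardy : 2 * intg (fun x => u x * phi x) <=
  4 / (N%:R - 2) ^+ 2 * intg (fun x => norm2 (g x)) +
  intg (fun x => norm2 (x - a) * phi x ^+ 2).
Proof.
rewrite -/G -/X.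
have F0 : F 0 = intg (fun x => u x * phi x).
  congr intg; apply/funext => x; rewrite /dilate mulr0 oppr0 expR0 mul1r; congr (_ * phi _).
  by apply/rowP => i; rewrite dilE oppr0 expR0 mul1r addrC subrK.
pose B := kap^-1 * G + kap * X.
have BE : 4 / (N%:R - 2) ^+ 2 * G + X = B / kap.
  by rewrite /B /kap; field; move: kap0; rewrite /kap; apply: contraTneq => ->; rewrite mul0r ltxx.
rewrite BE -F0.
pose H t := 2 * F t - B / kap * expR (- (kap * t)).
have dH t : is_derive t (1 : R) H (2 * F' t + B * expR (- (kap * t))).
  have h1 := is_deriveZ 2 (is_derive_intg_dilate t).
  have h2 := is_deriveN (is_deriveZ kap (is_derive_id t (1 : R))).
  have h3 := @is_derive1_comp R expR _ t _ _ (is_derive_expR _) h2.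
  have h4 := is_deriveB h1 (is_deriveZ (B / kap) h3).
  apply: is_derive_eq h4 _; rewrite -![_ *: _]/(_ * _) mulr1 -/(F' t); congr (_ + _).
  by rewrite mulrN mulrN opprK; field; rewrite gt_eqF.
have H_nd T : 0 <= T -> H 0 <= H T.
  move=> T0; apply: (@ger0_derive1_ndecr R H 0 T) => //.
  - move=> t _; rewrite derive1E (@derive_val _ _ _ _ _ _ _ (dH t)).
    have := sum_theta_le t; rewrite -/B; lra.
  - apply: derivable_within_continuous => t _; by have [] := dH t.
apply/ler_addgt0Pr => e e0.
pose c := intg (fun x => u x ^+ 2) + intg (fun x => phi x ^+ 2).
have c0 : 0 <= c by rewrite addr_ge0// intg_ge0// => x; rewrite sqr_ge0.
have N0 : 0 < N%:R / 2 :> R by rewrite divr_gt0// ltr0n (leq_trans _ hN).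
(* At this time e^(-NT/2) c <= e, because e^y >= 1 + y. *)
pose T := (c / e) / (N%:R / 2).
have T0 : 0 <= T by rewrite !divr_ge0// ltW.
have := H_nd T T0; rewrite /H mulr0 oppr0 expR0 mulr1 => HT.
have B0 : 0 <= B / kap * expR (- (kap * T)).
  rewrite mulr_ge0 ?expR_ge0// -BE addr_ge0//; last first.
    by apply: intg_ge0 => x; rewrite mulr_ge0 ?norm2_ge0 ?sqr_ge0.
  rewrite mulr_ge0 ?divr_ge0 ?sqr_ge0//; apply: intg_ge0 => x; exact: norm2_ge0.
have : 2 * F T <= e.
  apply: le_trans (F_infty T) _; rewrite -/c.
  rewrite expRN mulrC ler_pdivrMr ?expR_gt0//.
  have := expR_ge1Dx (N%:R / 2 * T); rewrite {1}/T mulrCA divff ?gt_eqF// mulr1 => h.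
  apply: le_trans (_ : c <= e * (1 + c / e)) _; last by rewrite ler_wpM2l// ltW.
  by rewrite mulrDr mulr1 mulrCA divff ?gt_eqF// mulr1 lerDr ltW.
lra.
Qed.

End dilation.
End dual.

(** * Density of test functions *)

Section dominated.
Context {R : realType} {N : nat}.
Implicit Types (f g h : 'rV[R]_N -> R).

Lemma intg_cvg (h_ : nat -> 'rV[R]_N -> R) h G :
  (forall n, measurable_fun setT (h_ n)) ->
  (forall x, h_ n x @[n --> \oo] --> h x) ->
  integrable_rV G -> (forall n x, `|h_ n x| <= G x) ->
  intg (h_ n) @[n --> \oo] --> intg h.
Proof.
move=> mh ch sG hG.
have mh' : measurable_fun setT h.
  by apply: (measurable_fun_cvg (h := h_)) => // x _; exact: ch.
have [||||sh _ H] := @dominated_convergence _ _ R (leb_rV R N) setT measurableT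
  (fun n x => (h_ n x)%:E) (EFin \o h) (EFin \o G) _ _ _ sG.
- by move=> n; exact/measurable_EFinP.
- exact/measurable_EFinP.
- by apply: aeW => x _; apply: cvg_EFin; [exact: nearW|exact: ch].
- by apply: aeW => x n _ /=; rewrite lee_fin.
by apply: fine_cvg; rewrite EFin_intg.
Qed.

End dominated.

Section approx.
Context {R : realType} {N : nat}.
Variable w : 'rV[R]_N -> R.
Hypothesis cw : continuous w.
Hypothesis w0 : forall x, 0 <= w x.
Implicit Types (f g h : 'rV[R]_N -> R).

(** Bounded measurable functions of bounded support. They are integrable
    with any continuous weight, and contain both the test functions and the
    truncations to which the duality is applied. *)
Definition cube_bounded f := measurable_fun setT f /\
  exists C M, forall x, `|f x| <= C * \1_(cube M) x.

Lemma cube_boundedP f : cube_bounded f <->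
  [/\ measurable_fun setT f, exists C, forall x, `|f x| <= C &
      exists M, forall x, f x != 0 -> cube M x].
Proof.
split=> [[mf [C [M h]]]|[mf [C hC] [M hM]]]; split => //.
- exists `|C| => x; apply: le_trans (h x) _; rewrite indicE.
  by case: (_ \in _); rewrite ?mulr1 ?mulr0// ler_norm.
- exists M => x; apply: contra_neqP => nMx; apply/eqP.
  rewrite -normr_le0; apply: le_trans (h x) _; rewrite indicE memNset ?mulr0//.
- exists C, M => x; rewrite indicE; case: (boolP (x \in cube M)) => [_|].
    by rewrite mulr1.
  rewrite notin_setE => Mx; rewrite mulr0 normr_le0; apply: contra_notT Mx.
  exact: hM.
Qed.

Lemma cube_boundedM h f : continuous h -> cube_bounded f ->
  cube_bounded (fun x => h x * f x).
Proof.
move=> ch [mf [C [M hC]]]; split.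
  by apply: measurable_funM => //; exact: continuous_measurable_rV.
have : compact (h @` cube M).
  apply: continuous_compact; last exact: compact_cube.
  exact: continuous_subspaceT.
move=> /compact_bounded /ex_strict_bound_gt0[D D0 hD].
exists (D * C), M => x; rewrite normrM -mulrA.
have := hC x; rewrite indicE; case: (boolP (x \in cube M)) => [|_].
  rewrite inE => Mx h1; apply: ler_pM => //.
  by apply: ltW; apply: hD; exists x.
by rewrite !mulr0 normr_le0 => /eqP ->; rewrite normr0 mulr0.
Qed.

Lemma cube_boundedX f n : cube_bounded f -> cube_bounded (fun x => f x ^+ n.+1).
Proof.
move=> /cube_boundedP[mf [C hC] [M hM]]; apply/cube_boundedP; split.
- exact: measurable_funX.
- exists (C ^+ n.+1) => x; rewrite normrX; apply: lerXn2r; rewrite ?nnegrE//.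
  exact: le_trans (hC x).
- by exists M => x; rewrite expf_eq0/=; exact: hM.
Qed.

Lemma subset_cube (M M' : R) : M <= M' -> cube M `<=` (cube M' : set 'rV[R]_N).
Proof. by move=> MM' x Mx i; exact: le_trans (Mx i) MM'. Qed.

Lemma cube_boundedD f g : cube_bounded f -> cube_bounded g ->
  cube_bounded (fun x => f x + g x).
Proof.
move=> /cube_boundedP[mf [C hC] [M hM]] /cube_boundedP[mg [D hD] [M' hM']].
apply/cube_boundedP; split.
- exact: measurable_funD.
- by exists (C + D) => x; apply: le_trans (ler_normD _ _) _; exact: lerD.
- exists (Num.max M M') => x.
  have [fx|/hM Mx] := eqVneq (f x) 0; last first.
    by move=> _; apply: subset_cube Mx; rewrite le_max lexx.
  by rewrite fx add0r => /hM'; apply: subset_cube; rewrite le_max lexx orbT.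
Qed.

Lemma cube_boundedZ c f : cube_bounded f -> cube_bounded (fun x => c * f x).
Proof. by apply: (cube_boundedM (h := fun=> c)) => x; exact: cst_continuous. Qed.

Lemma cube_boundedB f g : cube_bounded f -> cube_bounded g ->
  cube_bounded (fun x => f x - g x).
Proof.
move=> bf bg; under eq_fun do rewrite -mulN1r.
by apply: cube_boundedD => //; exact: cube_boundedZ.
Qed.

Lemma elementary_cube_bounded f (M : R) : elementary f ->
  (forall x, f x != 0 -> cube M x) -> cube_bounded f.
Proof.
move=> ef fM; have cf := continuous_elementary ef.
have [C _ hC] := continuous_cube_bounded cf fM.
by split; [exact: continuous_measurable_rV|exists C, M].
Qed.

Lemma integrable_cube_bounded f : cube_bounded f -> integrable_rV f.
Proof. by move=> [mf [C [M]]]; exact: integrable_rV_cube_bounded. Qed.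

(** The squared distance in L2 with weight [w]; using squares instead of norms,
    with the inequality [(x + y)^2 <= 2 x^2 + 2 y^2], dispenses with Minkowski. *)
Definition dist2 f g := intg (fun x => w x * (f x - g x) ^+ 2).

Lemma integrable_dist2 f g : cube_bounded f -> cube_bounded g ->
  integrable_rV (fun x => w x * (f x - g x) ^+ 2).
Proof.
move=> bf bg; apply: integrable_cube_bounded; apply: cube_boundedM => //.
exact/(@cube_boundedX _ 1)/cube_boundedB.
Qed.

Definition approximable f := cube_bounded f /\ forall e : R, 0 < e ->
  exists phi : 'rV[R]_N -> R, [/\ elementary phi, exists M, forall x, phi x != 0 -> cube M x &
    dist2 f phi <= e].

Lemma approximable_elementary f M : elementary f -> (forall x, f x != 0 -> cube M x) ->
  approximable f.
Proof.
move=> ef fM; split; first exact: elementary_cube_bounded ef fM.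
move=> e e0; exists f; split; [by []|by exists M|].
rewrite /dist2; under eq_fun do rewrite subrr expr0n mulr0.
by rewrite /intg /Rintegral integral0 ltW.
Qed.

Lemma dist2_trans f g h : cube_bounded f -> cube_bounded g -> cube_bounded h ->
  dist2 f h <= 2 * dist2 f g + 2 * dist2 g h.
Proof.
move=> bf bg bh; rewrite -!intgZ; try exact: integrable_dist2.
rewrite -intgD; try by apply: integrable_rVZ; exact: integrable_dist2.
apply: le_intg; first exact: integrable_dist2.
  by apply: integrable_rVD; apply: integrable_rVZ; exact: integrable_dist2.
move=> x; rewrite !mulrA ![2 * w x]mulrC -!mulrA -mulrDr ler_wpM2l//.
rewrite -subr_ge0 (_ : _ - _ = (f x - g x - (g x - h x)) ^+ 2) ?sqr_ge0//; ring.
Qed.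

(** The class of approximable functions is closed under dominated pointwise
    limits: dominated convergence turns them into limits for [dist2]. *)
Lemma approximable_limit (f_ : nat -> 'rV[R]_N -> R) f (C M : R) :
  (forall n, approximable (f_ n)) ->
  (forall n x, `|f_ n x| <= C * \1_(cube M) x) ->
  (forall x, f_ n x @[n --> \oo] --> f x) ->
  approximable f.
Proof.
move=> af hC cf.
have bf : cube_bounded f.
  split.
    apply: (measurable_fun_cvg (h := f_)) => [n|x _]; last exact: cf.
    by have [[]] := af n.
  exists C, M => x; rewrite -(cvg_lim _ (cvg_norm (cf x)))//.
  by apply: limr_le; [apply/cvg_ex; exists `|f x|; exact: cvg_norm|exact: nearW].
split=> // e e0.
have C0 (x : 'rV[R]_N) : 0 <= C * \1_(cube M) x by exact: le_trans (normr_ge0 _) (hC 0%N x).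
have h1 : dist2 f (f_ n) @[n --> \oo] --> 0.
  have -> : 0 = intg (fun x : 'rV[R]_N => 0) :> R by rewrite /intg /Rintegral integral0.
  pose G (x : 'rV[R]_N) := w x * (2 * (C * \1_(cube M) x)) ^+ 2.
  apply: (@intg_cvg R N _ _ G).
  - by move=> n; apply: measurable_integrable_rV; apply: integrable_dist2 => //; case: (af n).
  - move=> x; rewrite -(mulr0 (w x)); apply: cvgMr.
    have h : f x - f_ n x @[n --> \oo] --> (0 : R).
      by rewrite -(subrr (f x)); apply: cvgB; [exact: cvg_cst|exact: cf].
    rewrite -[X in _ --> X](mulr0 (0 : R)); under eq_fun do rewrite expr2.
    exact: cvgM.
  - apply: integrable_cube_bounded; apply: cube_boundedM => //.
    apply: (@cube_boundedX _ 1); do 2 apply: cube_boundedZ.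
    split; first by apply: measurable_indic; exact: measurable_cube.
    by exists 1, M => x; rewrite mul1r ger0_norm.
  - move=> n x; rewrite /G. rewrite normrM (ger0_norm (w0 x)) ler_wpM2l// normrX.
    apply: lerXn2r; rewrite ?nnegrE//.
      by rewrite mulr_ge0.
    rewrite mulr_natl mulr2n; apply: le_trans (ler_normB _ _) _; apply: lerD => //.
    rewrite -(cvg_lim _ (cvg_norm (cf x)))//.
    by apply: limr_le; [apply/cvg_ex; exists `|f x|; exact: cvg_norm|exact: nearW].
have e4 : 0 < e / 4 by rewrite divr_gt0.
have [n _ /(_ n (leqnn n))] := (cvgrPdist_lt _ _).1 h1 _ e4.
rewrite /= sub0r normrN => hn.
have [bn /(_ _ e4)[phi [ephi [M' phiM] hphi]]] := af n.
exists phi; split; [by []|by exists M'|].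
apply: le_trans (dist2_trans bf bn (elementary_cube_bounded ephi phiM)) _.
have := ler_norm (dist2 f (f_ n)); lra.
Qed.

Lemma approximableZ c f : approximable f -> approximable (fun x => c * f x).
Proof.
move=> [bf af]; split=> [|e e0]; first exact: cube_boundedZ.
have c0 : 0 < c ^+ 2 + 1 by rewrite ltr_wpDl// sqr_ge0.
have [phi [ephi [M phiM] h]] := af _ (divr_gt0 e0 c0).
have bphi := elementary_cube_bounded ephi phiM.
exists (fun x => c * phi x); split.
- by apply: elementaryM => //; exact: elementary_cst.
- by exists M => x; rewrite mulf_eq0 negb_or => /andP[_]; exact: phiM.
have -> : dist2 (fun x => c * f x) (fun x => c * phi x) = c ^+ 2 * dist2 f phi.
  rewrite -intgZ; last exact: integrable_dist2.
  by congr intg; apply/funext => x; ring.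
apply: le_trans (_ : c ^+ 2 * (e / (c ^+ 2 + 1)) <= e); first by rewrite ler_wpM2l ?sqr_ge0.
by rewrite mulrCA ler_piMr ?(ltW e0)// ler_pdivrMr// mul1r lerDl.
Qed.

Lemma approximableD f g : approximable f -> approximable g ->
  approximable (fun x => f x + g x).
Proof.
move=> [bf af] [bg ag]; split=> [|e e0]; first exact: cube_boundedD.
have e4 : 0 < e / 4 by rewrite divr_gt0.
have [phi [ephi [M phiM] hf]] := af _ e4.
have [psi [epsi [M' psiM] hg]] := ag _ e4.
have bphi := elementary_cube_bounded ephi phiM.
have bpsi := elementary_cube_bounded epsi psiM.
exists (fun x => phi x + psi x); split.
- exact: elementaryD.
- exists (Num.max M M') => x.
  have [->|/phiM Mx] := eqVneq (phi x) 0; last first.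
    by move=> _; apply: subset_cube Mx; rewrite le_max lexx.
  by rewrite add0r => /psiM; apply: subset_cube; rewrite le_max lexx orbT.
have h : dist2 (fun x => f x + g x) (fun x => phi x + psi x) <= 2 * dist2 f phi + 2 * dist2 g psi.
  rewrite -!intgZ; try exact: integrable_dist2.
  rewrite -intgD; try by apply: integrable_rVZ; exact: integrable_dist2.
  apply: le_intg.
  - by apply: integrable_dist2; exact: cube_boundedD.
  - by apply: integrable_rVD; apply: integrable_rVZ; exact: integrable_dist2.
  move=> x; rewrite !mulrA ![2 * w x]mulrC -!mulrA -mulrDr ler_wpM2l//.
  rewrite -subr_ge0 (_ : _ - _ = (f x - phi x - (g x - psi x)) ^+ 2) ?sqr_ge0//; ring.
lra.
Qed.

Lemma approximable_sum (F : nat -> 'rV[R]_N -> R) n : (forall i, approximable (F i)) ->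
  approximable (fun x => \sum_(i < n) F i x).
Proof.
move=> aF; elim: n => [|n IH].
  under eq_fun do rewrite big_ord0.
  by apply: (@approximable_elementary _ 0); [exact: elementary_cst|move=> x; rewrite eqxx].
by under eq_fun do rewrite big_ord_recr; exact: approximableD.
Qed.

Lemma cvg_flat_indic (t : R) : flat 1 (k%:R * t) @[k --> \oo] --> ((0 < t)%R%:R : R).
Proof.
have [t0|t0] := ltP 0 t; last first.
  rewrite (_ : (fun k => _) = cst 0); first exact: cvg_cst.
  by apply/funext => k; rewrite /flat ltNge mulr_ge0_le0.
rewrite -cvg_shiftS.
rewrite (_ : (fun k => _) = (fun k => expR (- (k.+1%:R^-1 * t^-1)))); last first.
  by apply/funext => k; rewrite /= /flat mulr_gt0// hornerC mul1r invfM.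
have h : - (k.+1%:R^-1 * t^-1) @[k --> \oo] --> (- (0 * t^-1) : R).
  by apply: cvgN; apply: cvgMl; exact: cvg_harmonic.
have : expR (- (k.+1%:R^-1 * t^-1)) @[k --> \oo] --> expR (- (0 * t^-1) : R).
  by apply: continuous_cvg h; exact: continuous_expR.
by rewrite mul0r oppr0 expR0.
Qed.

(** A pi-system, since [{F > 0}] and [{G > 0}] meet in
    [{flat 1 (F) * flat 1 (G) > 0}]; its members are approximable by the very form
    of their definition. *)
Definition positivity_sets : set (set 'rV[R]_N) :=
  [set A | exists2 F, elementary F & A = [set x | 0 < F x]].

(** The half spaces [{x_i > c}] are members and generate the sigma-algebra. *)
Lemma measurable_positivity_sets : @measurable _ 'rV[R]_N = <<s positivity_sets >>.
Proof.
apply/seteqP; split; last first.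
  apply: smallest_sub; first exact: sigma_algebra_measurable.
  move=> _ [F eF ->]; apply: open_measurable_rV.
  rewrite -preimage_itvoy; move: (continuous_elementary eF) => /continuousP; apply.
  exact: rray_open.
apply: smallest_sub; first exact: smallest_sigma_algebra.
rewrite -bigcup_seq/=; apply: bigcup_sub => i _ A [B mB <-].
pose T := g_sigma_algebraType positivity_sets.
have : measurable_fun [set: T] ((fun x => x 0 i) : T -> measurableTypeR R).
  apply: (measurability _ (RGenOInfty.measurableE R)) => /= _ [_ [c ->] <-].
  apply: sub_sigma_algebra; exists (fun x => x 0 i + - c).
    by apply: elementaryD; [exact: elementary_coord|exact: elementary_cst].
  by apply/seteqP; split => x /=; rewrite in_itv/= andbT subr_gt0 => // -[].
by move=> /(_ measurableT B mB).
Qed.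

(** A generated function whose positivity set lies between two cubes: it serves
    to cut off supports inside the class. *)
Lemma cube_ball (M : R) : exists2 b : 'rV[R]_N -> R, elementary b &
  (forall x, cube M x -> 0 < b x) /\ exists M', forall x, 0 < b x -> cube M' x.
Proof.
(* The bound exceeds 1, so that y ^ 2 <= K implies y <= K. *)
pose K : R := N%:R * M ^+ 2 + 1.
have K1 : 1 <= K by rewrite lerDr mulr_ge0// sqr_ge0.
exists (fun x => K + -1 * \sum_i x 0 i * x 0 i).
  apply: elementaryD; first exact: elementary_cst.
  apply: elementaryM; first exact: elementary_cst.
  by apply: elementary_sum => i; apply: elementaryM; exact: elementary_coord.
split=> [x Mx|].
  rewrite mulN1r subr_gt0 /K; apply: (@le_lt_trans _ _ (N%:R * M ^+ 2)); last first.
    by rewrite ltrDl.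
  rewrite (_ : N%:R * M ^+ 2 = \sum_(i < N) M ^+ 2); last first.
    by rewrite sumr_const card_ord mulr_natl.
  apply: ler_sum => i _; rewrite -expr2 -(real_normK (num_real (x 0 i))).
  have := Mx i => h; apply: lerXn2r => //; rewrite nnegrE//.
  exact: le_trans h.
exists K => x; rewrite mulN1r subr_gt0 => h i.
have : x 0 i * x 0 i <= K.
  apply: ltW; apply: le_lt_trans h; rewrite (bigD1 i)//= lerDl.
  by apply: sumr_ge0 => j _; rewrite -expr2 sqr_ge0.
rewrite -expr2 -(real_normK (num_real (x 0 i))).
have [x1|x1] := leP `|x 0 i| 1; first by move=> _; exact: le_trans x1 K1.
by apply: le_trans; rewrite expr2 ler_pMl ?ltW// (lt_trans _ x1).
Qed.

(** The sets whose trace on the ball [B] has an approximable indicator form a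
    Dynkin system. It contains the positivity sets, because
    [flat 1 (k F) * flat 1 (k b)] is a test function for each [k] and converges to
    the indicator of [{F > 0} /\ {b > 0}] as [k] grows. *)
Lemma approximable_indic (A : set 'rV[R]_N) (M : R) : measurable A ->
  A `<=` cube M -> approximable \1_A.
Proof.
move=> mA AM; have [b eb [bM [M' bM']]] := cube_ball M.
(* The cut-off: a bounded open set containing the cube, in the class. *)
pose B := [set x | 0 < b x].
have B01 (D : set 'rV[R]_N) x : `|\1_(D `&` B) x| <= 1 * \1_(cube M') x :> R.
  rewrite mul1r !indicE; case: (boolP (x \in D `&` B)) => [|_]; last by rewrite normr0.
  by rewrite inE => -[_ /bM' /mem_set ->]; rewrite normr1.
have posB F : elementary F -> approximable \1_([set x | 0 < F x] `&` B).
  move=> eF; apply: (@approximable_limit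
    (fun k x => flat 1 (k%:R * F x) * flat 1 (k%:R * b x)) _ 1 M').
  - move=> k; apply: (@approximable_elementary _ M').
      by apply: elementaryM; apply: elementary_flat; apply: elementaryM => //; exact: elementary_cst.
    move=> x; rewrite mulf_eq0 negb_or => /andP[_ h]; apply: bM'.
    have : 0 < flat 1 (k%:R * b x) by rewrite lt_def h; case/andP: (flat_le1 (k%:R * b x)).
    rewrite flat_gt0; case: k {h} => [|k]; first by rewrite mul0r ltxx.
    by rewrite pmulr_rgt0.
  - move=> k x; have /andP[f0 f1] := flat_le1 (k%:R * F x).
    have /andP[g0 g1] := flat_le1 (k%:R * b x).
    rewrite mul1r ger0_norm ?mulr_ge0// indicE; case: (boolP (x \in cube M')) => [_|].
      by rewrite mulr_ile1.
    rewrite notin_setE => nM; rewrite (_ : flat 1 (k%:R * b x) = 0) ?mulr0//.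
    apply/eqP; rewrite eq_le g0 andbT leNgt flat_gt0; apply/negP => h; apply: nM; apply: bM'.
    by case: k h {f0 f1 g0 g1} => [|k]; [rewrite mul0r ltxx|rewrite pmulr_rgt0].
  - move=> x; have -> : \1_([set x | 0 < F x] `&` B) x = (0 < F x)%R%:R * (0 < b x)%R%:R :> R.
      rewrite indicE in_setI -natrM mulnb; congr ((_ && _)%:R).
        by apply/idP/idP; rewrite inE.
      by apply/idP/idP; rewrite inE.
    by apply: cvgM; exact: cvg_flat_indic.
have aB : approximable \1_B.
  have := posB (fun=> 1) (elementary_cst 1).
  by rewrite (_ : [set x | _] = setT) ?setTI// -subTset => x _ /=.
suff : approximable \1_(A `&` B).
  by rewrite setIidl// => x /AM /bM.
move: A {AM} mA; rewrite measurable_positivity_sets.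
apply: (dynkin_induction (G := positivity_sets) (P := fun A => approximable \1_(A `&` B))).
- exact: measurable_positivity_sets.
- move=> _ _ [F eF ->] [F' eF' ->]; exists (fun x => flat 1 (F x) * flat 1 (F' x)).
    by apply: elementaryM; exact: elementary_flat.
  apply/seteqP; split=> x /=.
    by move=> [h h']; rewrite mulr_gt0// flat_gt0.
  have /andP[f0 _] := flat_le1 (F x); have /andP[g0 _] := flat_le1 (F' x).
  rewrite -(flat_gt0 (F x)) -(flat_gt0 (F' x)) => h.
  by split; rewrite lt_def ?f0 ?g0 andbT; apply: contraTneq h => ->; rewrite ?mulr0 ?mul0r ltxx.
- by rewrite setTI.
- by move=> _ [F eF ->]; exact: posB.
- move=> S _ aS; have -> : \1_(~` S `&` B) = (fun x => \1_B x + -1 * \1_(S `&` B) x) :> (_ -> R).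
    apply/funext => x; rewrite !indicE !in_setI in_setC.
    by case: (x \in S); case: (x \in B); rewrite /= mulN1r ?subr0 ?subrr.
  by apply: approximableD => //; exact: approximableZ.
- move=> F mF tF aF.
  have sumE k x n : F k x ->
      \sum_(i < n) \1_(F i `&` B) x = (k < n)%N%:R * \1_B x :> R.
    move=> Fk; have h i : \1_(F i `&` B) x = (i == k)%:R * \1_B x :> R.
      rewrite !indicE in_setI -natrM mulnb; congr ((_ && _)%:R).
      have [->|ik] := eqVneq i k; first by rewrite mem_set.
      apply: memNset => Fi; move/trivIsetP : tF => /(_ i k Logic.I Logic.I ik) FF.
      by have : (F i `&` F k) x by []; rewrite FF.
    under eq_bigr do rewrite h; rewrite -mulr_suml; congr (_ * _).
    have [kn|kn] := ltnP k n.
      rewrite (bigD1 (Ordinal kn))//= eqxx big1 ?addr0// => i.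
      by rewrite -val_eqE /= => /negbTE ->.
    by rewrite big1// => i _; rewrite ltn_eqF// (leq_trans (ltn_ord i)).
  have sum0 x n : ~ (\bigcup_k F k) x -> \sum_(i < n) \1_(F i `&` B) x = 0 :> R.
    move=> nF; rewrite big1// => k _; rewrite indicE memNset// => -[Fk _].
    by apply: nF; exists k.
  apply: (@approximable_limit (fun n x => \sum_(i < n) \1_(F i `&` B) x) _ 1 M').
  + by move=> n; exact: (approximable_sum (F := fun i => \1_(F i `&` B))).
  + move=> n x; have [[k _ Fk]|nF] := pselect ((\bigcup_k F k) x); last first.
      by rewrite sum0// normr0 mul1r.
    rewrite (sumE k)//; apply: le_trans (B01 setT x); rewrite setTI normrM.
    by case: (k < n)%N; rewrite ?normr1 ?mul1r// normr0 mul0r.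
  + move=> x; have [[k _ Fk]|nF] := pselect ((\bigcup_k F k) x); last first.
      under eq_fun do rewrite sum0//.
      by rewrite indicE memNset; [exact: cvg_cst|case].
    have -> : \1_(\bigcup_k F k `&` B) x = \1_B x :> R.
      by rewrite !indicE in_setI mem_set//; exists k.
    apply: (@cvg_near_cst _ _ _ _ _) => //.
    by near=> n; rewrite (sumE k)// (_ : (k < n)%N) ?mul1r//; near: n; exists k.+1.
Unshelve. all: by end_near. Qed.

Lemma sum_lt_nat (n k : nat) : \sum_(i < n) ((i < k)%N : nat) = minn n k.
Proof.
elim: n => [|n IH]; first by rewrite big_ord0 min0n.
by rewrite big_ord_recr /= IH; case: (ltnP n k) => h; lia.
Qed.

(** The layers [{f >= (k+1)/(n+1)}] add up to the rounding down of [f] to a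
    multiple of [1/(n+1)]. *)
Lemma approximable_ge0 f : cube_bounded f -> (forall x, 0 <= f x) -> approximable f.
Proof.
move=> bf f0; have [mf [C hC] [M hM]] := (cube_boundedP f).1 bf.
pose A n k := [set x | k.+1%:R <= n.+1%:R * f x].
(* The number of layers below the bound C of f. *)
pose m n := Num.truncn (n.+1%:R * C).
pose f_ n x := n.+1%:R^-1 * \sum_(k < m n) \1_(A n k) x : R.
have n0 n : 0 < n.+1%:R :> R by [].
have f_E n x : f_ n x = (Num.truncn (n.+1%:R * f x))%:R / n.+1%:R.
  rewrite /f_ mulrC; congr (_ / _).
  have -> : \sum_(k < m n) \1_(A n k) x = (\sum_(k < m n) ((k < Num.truncn (n.+1%:R * f x))%N : nat))%:R :> R.
    rewrite natr_sum; apply: eq_bigr => k _; rewrite indicE truncn_gt_nat; congr (_%:R).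
    by congr (nat_of_bool _); apply/idP/idP; rewrite inE.
  rewrite sum_lt_nat (minn_idPr _)//; apply: le_truncn.
  by rewrite ler_pM2l//; exact: le_trans (ler_norm _) (hC x).
have f_le n x : 0 <= f_ n x <= f x.
  rewrite f_E divr_ge0//= ler_pdivrMr// mulrC truncn_le.
  by rewrite mulr_ge0.
have f_ge n x : f x - f_ n x <= n.+1%:R^-1.
  rewrite f_E -(ler_pM2r (n0 n)) mulrBl mulfVK ?lt0r_neq0// mulVf ?lt0r_neq0//.
  by rewrite mulrC; move: (n.+1%:R * f x) => y; have := truncnS_gt y; rewrite -natr1; lra.
apply: (@approximable_limit f_ f C M).
- move=> n; apply: approximableZ; apply: (approximable_sum (F := fun k => \1_(A n k))) => k.
  apply: (@approximable_indic _ M).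
    rewrite (_ : A n k = (fun x => n.+1%:R * f x) @^-1` `[k.+1%:R, +oo[%classic).
      rewrite -[X in measurable X]setTI; apply: measurable_funM => //.
    by apply/seteqP; split=> x /=; rewrite in_itv/= andbT.
  move=> x /= h; apply: hM; apply: contraTneq h => ->.
  by rewrite mulr0 -ltNge.
- move=> n x; have /andP[h0 h1] := f_le n x; rewrite ger0_norm//; apply: le_trans h1 _.
  rewrite indicE; case: (boolP (x \in cube M)) => [_|].
    by rewrite mulr1; exact: le_trans (ler_norm _) (hC x).
  rewrite notin_setE => nM; rewrite mulr0 le_eqVlt; apply/orP; left.
  by apply: contra_notT nM; exact: hM.
- move=> x; apply/cvgrPdist_le => e e0; near=> n.
  have /andP[h0 h1] := f_le n x.
  rewrite ger0_norm ?subr_ge0//; apply: le_trans (f_ge n x) _.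
  near: n; have [K _ hK] := (cvgrPdist_le _ _).1 (@cvg_harmonic R) e e0.
  by exists K => // k /hK; rewrite /= sub0r normrN ger0_norm.
Unshelve. all: by end_near. Qed.

Lemma approximable_cube_bounded f : cube_bounded f -> approximable f.
Proof.
move=> bf; have [mf [C hC] [M hM]] := (cube_boundedP f).1 bf.
have pospart g : cube_bounded g -> approximable (fun x => Num.max (g x) 0).
  move=> /cube_boundedP[mg [D hD] [K hK]]; apply: approximable_ge0; last first.
    by move=> x; rewrite le_max lexx orbT.
  apply/cube_boundedP; split.
  - by apply: measurable_maxr.
  - exists D => x; rewrite maxEle; case: ifP => _ //; rewrite normr0.
    exact: le_trans (normr_ge0 _) (hD x).
  - by exists K => x; rewrite maxEle; case: ifP => [_|_]; [rewrite eqxx|exact: hK].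
have -> : f = fun x => Num.max (f x) 0 + -1 * Num.max (-1 * f x) 0.
  apply/funext => x; rewrite !mulN1r; have [f0|f0] := leP (f x) 0.
    by rewrite max_l ?oppr_ge0// opprK add0r.
  by rewrite max_r ?subr0// oppr_le0 ltW.
apply: approximableD; first exact: pospart.
apply: approximableZ; apply: pospart; exact: cube_boundedZ.
Qed.

End approx.

(** * The Hardy inequality with one pole *)

Section hardy.
Context {R : realType} {N : nat}.
Variables (a : 'rV[R]_N) (u : 'rV[R]_N -> R) (g : 'rV[R]_N -> 'rV[R]_N).
Hypotheses (hN : (3 <= N)%N) (ug : H1 u g).

Lemma elementary_norm2 : elementary (fun x : 'rV[R]_N => norm2 (x - a)).
Proof.
apply: elementary_sum => i; under eq_fun do rewrite expr2 !mxE.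
by apply: elementaryM; apply: elementaryD; first [exact: elementary_coord|exact: elementary_cst].
Qed.

Lemma measurable_norm2V : measurable_fun setT (fun x : 'rV[R]_N => (norm2 (x - a))^-1).
Proof.
rewrite (_ : (fun _ => _) = (fun x : 'rV[R]_N => norm2 (x - a) `^ (-1))).
  have mn : measurable_fun setT (fun x : 'rV[R]_N => norm2 (x - a)).
    by apply: continuous_measurable_rV; apply: continuous_elementary; exact: elementary_norm2.
  by have := measurableT_comp (measurable_powR (-1)) mn.
by apply/funext => x; rewrite powR_inv1 ?norm2_ge0.
Qed.

(** Both sides of [dual_hardy] are continuous for the weight [1 + |x - a|^2]:
    the 1 controls the left side, where [u] is square integrable. *)
Lemma dual_hardy_bounded f : cube_bounded f ->
  2 * intg (fun x => u x * f x) <=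
  4 / (N%:R - 2) ^+ 2 * intg (fun x => norm2 (g x)) +
  intg (fun x => norm2 (x - a) * f x ^+ 2).
Proof.
move=> bf.
pose w (x : 'rV[R]_N) := 1 + norm2 (x - a).
have cn : continuous (fun x : 'rV[R]_N => norm2 (x - a)).
  by apply: continuous_elementary; exact: elementary_norm2.
have cw : continuous w.
  apply: continuous_elementary; apply: elementaryD; first exact: elementary_cst.
  exact: elementary_norm2.
have w0 x : 0 <= w x by rewrite addr_ge0// norm2_ge0.
have [_ af] := approximable_cube_bounded cw w0 bf.
have su : sqint u by case: ug => /L2_sqint.
have sqb (h : 'rV[R]_N -> R) : cube_bounded h -> sqint h.
  by move=> [mh [C [M hC]]]; apply: sqint_cube_bounded hC.
set A := _ * intg (fun x => norm2 (g x)).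
set X := intg (fun x => norm2 (x - a) * f x ^+ 2).
pose U := intg (fun x => u x ^+ 2).
have U0 : 0 <= U by apply: intg_ge0 => x; rewrite sqr_ge0.
have X0 : 0 <= X by apply: intg_ge0 => x; rewrite mulr_ge0 ?norm2_ge0 ?sqr_ge0.
have D0 : 0 < U + X + 3 by rewrite ltr_wpDl// addr_ge0.
apply/ler_addgt0Pr => e e0.
(* All errors caused by replacing f by phi add up to at most d (U + X + 3). *)
pose d := Num.min 1 (e / (U + X + 3)).
have d0 : 0 < d by rewrite lt_min ltr01 divr_gt0.
have d1 : d <= 1 by rewrite ge_min lexx.
have de : d * (U + X + 3) <= e by rewrite -ler_pdivlMr// ge_min lexx orbT.
have [phi [ephi [M phiM] hphi]] := af _ (exprn_gt0 2 d0).
have bphi := elementary_cube_bounded ephi phiM.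
have bfp := cube_boundedB bf bphi.
have s2 : integrable_rV (fun x => (f x - phi x) ^+ 2) by have [] := sqb _ bfp.
have sn (h : 'rV[R]_N -> R) : cube_bounded h -> integrable_rV (fun x => norm2 (x - a) * h x ^+ 2).
  by move=> bh; apply: integrable_cube_bounded; apply: cube_boundedM => //; exact: (@cube_boundedX _ _ _ 1).
have h1 := dual_hardy a ephi phiM ug hN.
have h2 : 2 * intg (fun x => u x * (f x - phi x)) <= d * U + d.
  rewrite -intgZ; last by apply: sqintM => //; exact: sqb.
  apply: (@le_trans _ _ (intg (fun x => d * u x ^+ 2 + d^-1 * (f x - phi x) ^+ 2))).
    apply: le_intg.
    - by apply: integrable_rVZ; apply: sqintM => //; exact: sqb.
    - by apply: integrable_rVD; apply: integrable_rVZ; [exact: su.2|exact: s2].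
    move=> x; apply: le_trans (young _ _ d0).
    by apply: le_trans (ler_norm _) _; rewrite normrM [`|2|]ger0_norm.
  rewrite intgD; try by apply: integrable_rVZ; first [exact: su.2|exact: s2].
  rewrite !intgZ; try first [exact: s2|exact: su.2].
  rewrite lerD2l mulrC ler_pdivrMr// -expr2; apply: le_trans hphi.
  apply: le_intg; [exact: s2|exact: integrable_dist2|].
  by move=> x; rewrite ler_peMl ?sqr_ge0// lerDl norm2_ge0.
have h3 : intg (fun x => norm2 (x - a) * phi x ^+ 2) <= (1 + d) * X + (1 + d^-1) * d ^+ 2.
  apply: (@le_trans _ _ ((1 + d) * X + (1 + d^-1) * dist2 w f phi)); last first.
    by rewrite lerD2l ler_wpM2l// addr_ge0// invr_ge0 ltW.
  rewrite -!intgZ; try first [exact: integrable_dist2|exact: sn].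
  rewrite -intgD; try by apply: integrable_rVZ; first [exact: sn|exact: integrable_dist2].
  apply: le_intg; first exact: sn.
    by apply: integrable_rVD; apply: integrable_rVZ; [exact: sn|exact: integrable_dist2].
  move=> x.
  apply: (@le_trans _ _ (norm2 (x - a) * ((1 + d) * f x ^+ 2 + (1 + d^-1) * (f x - phi x) ^+ 2))).
    rewrite ler_wpM2l ?norm2_ge0//.
    have := @young R (f x) (f x - phi x) d d0.
    have := ler_norm (f x * (f x - phi x)); have := ler_norm (- (f x * (f x - phi x))).
    rewrite normrN; nra.
  rewrite mulrDr mulrCA lerD2l mulrCA ler_wpM2l ?addr_ge0 ?invr_ge0 ?(ltW d0)//.
  by rewrite ler_wpM2r ?sqr_ge0// lerDr.
have h4 : intg (fun x => u x * f x) = intg (fun x => u x * phi x) + intg (fun x => u x * (f x - phi x)).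
  rewrite -intgD; try by apply: sqintM => //; exact: sqb.
  by congr intg; apply/funext => x; ring.
rewrite h4 mulrDr.
have dd : (1 + d^-1) * d ^+ 2 = d ^+ 2 + d by field; rewrite gt_eqF.
rewrite dd in h3; rewrite -/A in h1.
have : d ^+ 2 <= d by rewrite expr2 ler_piMl// ltW.
nra.
Qed.

(** The truncation [E k] keeps [u / |x - a|^2] bounded, and avoids the pole,
    at which the quotients are 0 by convention. *)
Lemma hardy : (((N%:R - 2) ^+ 2 / 4)%:E *
    \int[leb_rV R N]_x (`|u x| ^+ 2 / enorm (x - a) ^+ 2)%:E
  <= \int[leb_rV R N]_x (enorm (g x) ^+ 2)%:E)%E.
Proof.
pose n (x : 'rV[R]_N) := norm2 (x - a).
pose f (x : 'rV[R]_N) := u x ^+ 2 / n x.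
have -> : (\int[leb_rV R N]_x (`|u x| ^+ 2 / enorm (x - a) ^+ 2)%:E =
           \int[leb_rV R N]_x (f x)%:E)%E.
  by apply: eq_integral => x _; rewrite enorm_sqr real_normK// num_real.
have sg : integrable_rV (fun x => norm2 (g x)).
  apply: integrable_rV_sum => i; case: ug => _ /(_ i) /L2_sqint [_ +] _; exact.
have -> : (\int[leb_rV R N]_x (enorm (g x) ^+ 2)%:E = (intg (fun x => norm2 (g x)))%:E)%E.
  by rewrite EFin_intg//; apply: eq_integral => x _; rewrite enorm_sqr.
set G := intg _.
have [mu _] : sqint u by case: ug => /L2_sqint.
have N2 : 0 < (N%:R - 2 : R) by rewrite subr_gt0 ltr_nat.
have c0 : 0 < (N%:R - 2) ^+ 2 / 4 :> R by rewrite divr_gt0// exprn_gt0.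
have n0 x : 0 <= n x by exact: norm2_ge0.
have mn : measurable_fun setT n.
  apply: continuous_measurable_rV; apply: continuous_elementary; exact: elementary_norm2.
pose E k := [set x : 'rV[R]_N | `|u x| <= k.+1%:R] `&` [set x | k.+1%:R^-1 <= n x] `&` cube k.+1%:R.
have mE k : measurable (E k).
  apply: measurableI; last exact: measurable_cube.
  apply: measurableI.
    rewrite (_ : [set _ | _] = (fun x => `|u x|) @^-1` `]-oo, k.+1%:R]%classic).
      by rewrite -[X in measurable X]setTI; apply: measurableT_comp.
    by apply/seteqP; split=> x /=; rewrite in_itv.
  rewrite (_ : [set _ | _] = n @^-1` `[k.+1%:R^-1, +oo[%classic).
    by rewrite -[X in measurable X]setTI; apply: mn.
  by apply/seteqP; split=> x /=; rewrite in_itv/= andbT.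
have mf : measurable_fun setT f.
  by apply: measurable_funM; [exact: measurable_funX|exact: measurable_norm2V].
have f0 x : 0 <= f x by rewrite divr_ge0// sqr_ge0.
have bk k : cube_bounded (fun x => u x / n x * \1_(E k) x).
  split.
    apply: measurable_funM; last exact: measurable_indic.
    by apply: measurable_funM => //; exact: measurable_norm2V.
  exists (k.+1%:R * k.+1%:R), k.+1%:R => x; rewrite !indicE.
  case: (boolP (x \in E k)) => [|_]; last by rewrite mulr0 normr0 mulr_ge0 ?mulr_ge0.
  rewrite inE => -[[/= ux nx] Mx]; rewrite mem_set// !mulr1 normrM.
  apply: ler_pM => //; rewrite ger0_norm ?invr_ge0// invf_ple ?posrE//.
  exact: lt_le_trans nx.
have key k : intg (fun x => f x * \1_(E k) x) <= 4 / (N%:R - 2) ^+ 2 * G.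
  have := dual_hardy_bounded (bk k).
  have -> : (fun x => u x * (u x / n x * \1_(E k) x)) = (fun x => f x * \1_(E k) x).
    by apply/funext => x; rewrite /f expr2; ring.
  have -> : (fun x => norm2 (x - a) * (u x / n x * \1_(E k) x) ^+ 2) = (fun x => f x * \1_(E k) x).
    apply/funext => x; rewrite /f -/(n x) indicE.
    have [nx|nx] := eqVneq (n x) 0; first by rewrite nx invr0 !mulr0 !mul0r.
    by case: (x \in E k); rewrite ?mulr1 ?mulr0 ?expr0n ?mulr0//=; field.
  rewrite -/G; lra.
have sk k : integrable_rV (fun x => f x * \1_(E k) x).
  have -> : (fun x => f x * \1_(E k) x) = fun x => n x * (u x / n x * \1_(E k) x) ^+ 2.
    apply/funext => x; rewrite /f indicE.
    have [nx|nx] := eqVneq (n x) 0; first by rewrite nx invr0 !mulr0 !mul0r.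
    by case: (x \in E k); rewrite ?mulr1 ?mulr0 ?expr0n ?mulr0//=; field.
  apply: integrable_cube_bounded; apply: cube_boundedM.
    apply: continuous_elementary; exact: elementary_norm2.
  exact: (@cube_boundedX _ _ _ 1).
pose F k x := (f x * \1_(E k) x)%:E.
have mF k : measurable_fun setT (F k).
  by apply/measurable_EFinP; apply: measurable_funM => //; exact: measurable_indic.
have F0 k x : setT x -> (0 <= F k x)%E by rewrite lee_fin mulr_ge0.
have E_nd k l : (k <= l)%N -> E k `<=` E l.
  move=> kl x [[/= ux nx] Mx]; split; first split => /=.
  - by apply: le_trans ux _; rewrite ler_nat.
  - by apply: le_trans nx; rewrite lef_pV2 ?posrE// ler_nat.
  - by apply: subset_cube Mx; rewrite ler_nat.
have F_nd x : setT x -> {homo F^~ x : k l / (k <= l)%N >-> (k <= l)%E}.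
  move=> _ k l kl; rewrite lee_fin ler_wpM2l// !indicE.
  case: (boolP (x \in E k)) => //; rewrite inE => /(E_nd _ _ kl) Ex.
  by rewrite mem_set.
have Fl x : limn (F^~ x) = (f x)%:E.
  apply/cvg_lim => //; apply: cvg_EFin; first exact: nearW.
  have [nx|nx] := eqVneq (n x) 0.
    rewrite /f nx invr0 mulr0 (_ : _ \o _ = cst 0); first exact: cvg_cst.
    by apply/funext => k; rewrite /= /f nx invr0 mulr0 mul0r.
  apply: cvg_near_cst; near=> k.
  have [ku kn kx] : [/\ `|u x| <= k%:R, (n x)^-1 <= k%:R & `|x| <= k%:R].
    by split; near: k; exact: nbhs_infty_ger.
  have kS : k%:R <= k.+1%:R :> R by rewrite ler_nat.
  rewrite /= indicE mem_set ?mulr1//; split; first split => /=.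
  - exact: le_trans kS.
  - rewrite invf_ple ?posrE//; first exact: le_trans kS.
    by rewrite lt_def nx n0.
  - by apply/norm_rV_leP => //; exact: le_trans kS.
have := cvg_monotone_convergence (mu := leb_rV R N) measurableT mF F0 F_nd.
under eq_integral do rewrite Fl.
move=> H.
rewrite -lee_pdivlMl//.
rewrite -(cvg_lim _ H)//; apply: lime_le; first by apply/cvg_ex; eexists; exact: H.
apply: nearW => k; rewrite -[leLHS]EFin_intg// -EFinM lee_fin.
by apply: le_trans (key k) _; rewrite invf_div.
Unshelve. all: by end_near. Qed.

End hardy.

(** * Functions of the logarithm of the norm *)

Section positive_part.
Context {R : realType}.

Definition pospart (t : R) : R := Num.max 0 t.

Lemma pospart_ge0 t : 0 <= pospart t. Proof. by rewrite /pospart le_max lexx. Qed.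

(** The positive part may be replaced by its argument in all factors but one:
    this lets polynomial identities pass through truncations. *)
Lemma pospartXS t k : pospart t ^+ k.+2 = pospart t ^+ k.+1 * t.
Proof.
rewrite exprSr /pospart; have [t0|t0] := leP t 0.
  by rewrite exprS !mul0r.
by [].
Qed.

Lemma is_derive_pospartX k (t : R) :
  is_derive t (1 : R) (fun s => pospart s ^+ k.+2) (k.+2%:R * pospart t ^+ k.+1).
Proof.
elim: k => [|k IH].
  have [t0|t0|->] := ltgtP t 0.
  - rewrite /pospart max_l ?ltW// mulr0.
    apply: (@near_eq_is_derive _ _ _ (cst (0 : R))).
    near=> s; rewrite max_l ?expr0n//.
    by near: s; exact: lt_le_nbhsl.
  - rewrite {2}/pospart max_r ?ltW//.
    apply: (@near_eq_is_derive _ _ _ (fun s : R => s ^+ 2)).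
      near=> s; rewrite /pospart max_r//.
      by near: s; exact: lt_le_nbhsr.
    apply: is_derive_eq (is_deriveM (is_derive_id t (1 : R)) (is_derive_id t (1 : R))) _.
    by rewrite -![_ *: _]/(_ * _) mulr1 expr1; ring.
  - rewrite {2}/pospart maxxx mulr0; apply: (@is_derive_sqr_bound _ _ 1) => h.
    rewrite mul1r ger0_norm ?sqr_ge0//.
    rewrite -(real_normK (num_real h)); apply: lerXn2r; rewrite ?nnegrE ?pospart_ge0//.
    by rewrite /pospart ge_max normr_ge0 ler_norm.
have -> : (fun s : R => pospart s ^+ k.+3) = fun s => pospart s ^+ k.+2 * s.
  by apply/funext => s; rewrite pospartXS.
apply: is_derive_eq (is_deriveM IH (is_derive_id t (1 : R))) _.
rewrite -![_ *: _]/(_ * _) mulr1 [t * _]mulrCA [t * _]mulrC -pospartXS.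
by rewrite -[k.+3%:R]natr1; ring.
Unshelve. all: by end_near. Qed.

Lemma is_derive_continuous (F F' : R -> R) :
  (forall t, is_derive t (1 : R) F (F' t)) -> continuous F.
Proof.
by move=> dF t; apply: differentiable_continuous; apply/derivable1_diffP; have [] := dF t.
Qed.

Lemma continuous_expRN (k : R) : continuous (fun t : R => expR (- (k * t))).
Proof. exact: is_derive_continuous (is_derive_expRN k). Qed.

Lemma continuous_shiftR (F : R -> R) (s : R) : continuous F -> continuous (fun t => F (t - s)).
Proof.
move=> cF t; apply: (@continuous_comp _ _ _ (fun t => t - s) F); last exact: cF.
by apply: cvgB; [exact: cvg_id|exact: cvg_cst].
Qed.

Lemma continuous_pospart : continuous pospart.
Proof.
move=> t; apply: (continuous_max (f := cst (0 : R)) (g := id)); [exact: cst_continuous|exact: cvg_id].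
Qed.

End positive_part.

Section log_radial.
Context {R : realType} {N : nat}.

(** The logarithmic radial variable, twice the logarithm of the norm. *)
Definition ell (x : 'rV[R]_N) : R := ln (norm2 x).

(** At the origin [ell] is 0 by the convention on the logarithm of 0. The
    functions of [ell] integrated below are supported in the positive half line,
    so they do not see the origin. *)
Lemma norm2E x : 0 < ell x -> norm2 x = expR (ell x).
Proof.
move=> h; rewrite /ell lnK// posrE ltNge; apply/negP => x0.
by move: h; rewrite /ell ln0// ltxx.
Qed.

Lemma continuous_norm2 : continuous (@norm2 R N).
Proof.
have := @continuous_elementary R N _ (elementary_norm2 0).
by under eq_fun do rewrite subr0.
Qed.

Lemma measurable_ell : measurable_fun setT ell.
Proof.
by have := measurableT_comp (@measurable_ln R) (continuous_measurable_rV continuous_norm2).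
Qed.

Lemma coord_le_norm2 (x : 'rV[R]_N) i : `|x 0 i| <= 1 + norm2 x.
Proof.
have : x 0 i ^+ 2 <= norm2 x.
  by rewrite /norm2 (bigD1 i)//= lerDl sumr_ge0// => j _; rewrite sqr_ge0.
rewrite -(real_normK (num_real (x 0 i))); move: `|x 0 i| => y.
have := sqr_ge0 (y - 1); nra.
Qed.

Lemma log_radial_cube (H : R -> R) (al be : R) : 0 < al ->
  (forall t, H t != 0 -> al <= t <= be) ->
  forall x, H (ell x) != 0 -> cube (1 + expR be) x.
Proof.
move=> al0 hH x /hH /andP[h1 h2] i; apply: le_trans (coord_le_norm2 x i) _.
by rewrite lerD2l norm2E ?ler_expR// (lt_le_trans al0).
Qed.

Lemma log_radial_cube_bounded (H : R -> R) (al be : R) : 0 < al ->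
  (forall t, H t != 0 -> al <= t <= be) -> continuous H ->
  cube_bounded (fun x => H (ell x)).
Proof.
move=> al0 hH cH; apply/cube_boundedP; split.
- by have := measurableT_comp (continuous_measurable_fun cH) measurable_ell.
- have : compact (H @` `[al, be]%classic).
    by apply: continuous_compact; [exact: continuous_subspaceT|exact: segment_compact].
  move=> /compact_bounded /ex_strict_bound_gt0[C C0 hC]; exists C => x.
  have [->|/hH h] := eqVneq (H (ell x)) 0; first by rewrite normr0 ltW.
  by apply: ltW; apply: hC; exists (ell x) => //=; rewrite in_itv.
- by exists (1 + expR be); exact: log_radial_cube al0 hH.
Qed.

(** The integral of [|x|^(-N) F (ln |x|^2)]. In polar coordinates it is a
    multiple of the integral of [F] over the line. *)
Definition radint (F : R -> R) : R := intg (fun x => expR (- (N%:R / 2 * ell x)) * F (ell x)).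

Lemma weight_cube_bounded (F : R -> R) (al be : R) : 0 < al ->
  (forall t, F t != 0 -> al <= t <= be) -> continuous F ->
  cube_bounded (fun x => expR (- (N%:R / 2 * ell x)) * F (ell x)).
Proof.
move=> al0 hF cF.
apply: (@log_radial_cube_bounded (fun t => expR (- (N%:R / 2 * t)) * F t) al be) => //.
  by move=> t; rewrite mulf_eq0 negb_or => /andP[_]; exact: hF.
by move=> t; have := @continuous_expRN R (N%:R / 2) t; move=> /continuousM; apply; exact: cF.
Qed.

(** Dilations preserve the measure [|x|^(-N) dx] and translate [ell]. *)
Lemma radint_shift (F : R -> R) (al be s : R) : 0 < al -> 0 < al + s ->
  (forall t, F t != 0 -> al <= t <= be) -> continuous F ->
  radint (fun t => F (t - s)) = radint F.
Proof.
move=> al0 als hF cF.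
(* The ratio for which ell decreases by s. *)
pose c : R := expR (- (s / 2)).
have c0 : 0 < c by rewrite expR_gt0.
have sF := integrable_cube_bounded (weight_cube_bounded al0 hF cF).
have := @intg_affine R N 0 c _ c0 sF.
have F0 : F 0 = 0.
  by apply/eqP; apply: contraTT al0 => /hF /andP[h _]; rewrite -leNgt.
have Fs : F (0 - s) = 0.
  apply/eqP; apply: contraTT als => /hF /andP[h _]; rewrite -leNgt; lra.
have E : (fun x : 'rV[R]_N => expR (- (N%:R / 2 * ell (0 + c *: x))) * F (ell (0 + c *: x)))
   = fun x => c ^- N * (expR (- (N%:R / 2 * ell x)) * F (ell x - s)).
  apply/funext => x; rewrite add0r.
  have nc : norm2 (c *: x) = c ^+ 2 * norm2 x.
    by rewrite /norm2 mulr_sumr; apply: eq_bigr => i _; rewrite mxE exprMn.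
  have [x0|x0] := eqVneq (norm2 x) 0.
    by rewrite /ell nc x0 mulr0 ln0// F0 Fs !mulr0.
  have xp : 0 < norm2 x by rewrite lt_def x0 norm2_ge0.
  have -> : ell (c *: x) = ell x - s.
    rewrite /ell nc lnM ?posrE ?exprn_gt0// /c -expRM_natl expRK addrC; congr (_ + _); by field.
  rewrite mulrA; congr (_ * _).
  rewrite /c -expRM_natl -expRN -expRD; congr expR; by field.
have cN0 : 0 < c ^- N by rewrite invr_gt0 exprn_gt0.
rewrite E intgZ; first by move=> h; exact: (mulfI (lt0r_neq0 cN0)) h.
apply: integrable_cube_bounded; apply: (@weight_cube_bounded (fun t => F (t - s)) (al + s) (be + s)) => //.
  by move=> t /hF /andP[h1 h2]; apply/andP; split; lra.
exact: continuous_shiftR.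
Qed.

(** Differentiating the translation invariance. *)
Lemma radint_derive (F F' : R -> R) (al be : R) : 1 < al ->
  (forall t, is_derive t (1 : R) F (F' t)) -> continuous F' ->
  (forall t, F t != 0 -> al <= t <= be) ->
  (forall t, F' t != 0 -> al <= t <= be) ->
  radint F' = 0.
Proof.
move=> al1 dF cF' hF hF'.
have cF := is_derive_continuous dF.
have al0 : 0 < al by lra.
have shiftable (H : R -> R) s : (forall t, H t != 0 -> al <= t <= be) -> continuous H -> `|s| < 1 ->
    cube_bounded (fun x => expR (- (N%:R / 2 * ell x)) * H (ell x - s)).
  move=> hH cH; rewrite ltr_norml => /andP[s1 s2].
  apply: (@weight_cube_bounded (fun t => H (t - s)) (al + s) (be + s)); first by lra.
    by move=> t /hH /andP[h1 h2]; apply/andP; split; lra.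
  exact: continuous_shiftR.
have bF' : exists2 C, 0 <= C & forall t, `|F' t| <= C.
  have : compact (F' @` `[al, be]%classic).
    by apply: continuous_compact; [exact: continuous_subspaceT|exact: segment_compact].
  move=> /compact_bounded /ex_strict_bound_gt0[C C0 hC]; exists C => [|t]; first exact: ltW.
  have [->|/hF' h] := eqVneq (F' t) 0; first by rewrite normr0 ltW.
  by apply: ltW; apply: hC; exists t => //=; rewrite in_itv.
have [C C0 hC] := bF'.
have H := @is_derive_intg R N (fun s x => expR (- (N%:R / 2 * ell x)) * F (ell x - s))
  (fun s x => expR (- (N%:R / 2 * ell x)) * - F' (ell x - s)) 0
  (fun x => C * \1_(cube (1 + expR (be + 1))) x).
have {}H := H _ _ _ (integrable_rVZ C (integrable_rV_cube _)).
have n01 : \forall s \near (0 : R), `|s| < 1 by exact: (nbhs0_lt ltr01).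
have D : is_derive (0 : R) (1 : R)
   (fun s => intg (fun x : 'rV[R]_N => expR (- (N%:R / 2 * ell x)) * F (ell x - s))) (0 : R).
  apply: (@near_eq_is_derive _ _ _ (cst (radint F))).
  near=> s; apply/esym; apply: (@radint_shift F al be s) => //.
  have : `|s| < 1 by near: s; exact: n01.
  rewrite ltr_norml => /andP[s1 s2]; lra.
have {H} : is_derive (0 : R) (1 : R)
   (fun s => intg (fun x : 'rV[R]_N => expR (- (N%:R / 2 * ell x)) * F (ell x - s)))
   (intg (fun x : 'rV[R]_N => expR (- (N%:R / 2 * ell x)) * - F' (ell x - 0))).
  apply: H.
  - move=> s x _.
    have h1 := is_deriveB (is_derive_cst (ell x) s (1 : R)) (is_derive_id s (1 : R)).
    have h2 := @is_derive1_comp R F _ s _ _ (dF _) h1.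
    have := is_deriveZ (expR (- (N%:R / 2 * ell x))) h2.
    by rewrite sub0r mulrN1.
  - by move=> s; rewrite subr0 => s1; apply: integrable_cube_bounded; exact: shiftable.
  - move=> s x; rewrite subr0 => s1; rewrite normrM normrN ger0_norm ?expR_ge0//.
    have [->|F'x] := eqVneq (F' (ell x - s)) 0.
      by rewrite normr0 mulr0 mulr_ge0.
    have /andP[h1 h2] := hF' _ F'x.
    move: s1; rewrite ltr_norml => /andP[s1 s2].
    have ex0 : 0 < ell x by lra.
    rewrite indicE mem_set ?mulr1; last first.
      by apply: (@log_radial_cube (fun t => F' (t - s)) (al + s) (be + 1) _ _ x F'x); 
         [lra|move=> t /hF' /andP[h3 h4]; apply/andP; split; lra].
    rewrite -[leRHS]mul1r; apply: ler_pM; rewrite ?expR_ge0//.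
    by rewrite -expR0 ler_expR oppr_le0 !mulr_ge0// ltW.
move=> H; have := @derive_val _ _ _ _ _ _ _ D; rewrite (@derive_val _ _ _ _ _ _ _ H).
have -> : (fun x : 'rV[R]_N => expR (- (N%:R / 2 * ell x)) * - F' (ell x - 0)) =
  fun x => -1 * (expR (- (N%:R / 2 * ell x)) * F' (ell x)).
  by apply/funext => x; rewrite subr0; ring.
rewrite intgZ; last exact: integrable_cube_bounded (weight_cube_bounded al0 hF' cF').
by rewrite -/(radint F') mulN1r => /eqP; rewrite oppr_eq0 => /eqP.
Unshelve. all: by end_near. Qed.

End log_radial.

(** * Compactly supported functions with classical derivatives *)

Section parts.
Context {R : realType} {N : nat}.

Lemma cube_bounded_sqint (f : 'rV[R]_N -> R) : cube_bounded f -> sqint f.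
Proof. by move=> [mf [C [M]]]; exact: sqint_cube_bounded. Qed.

(** Both sides are limits of the same difference quotient. *)
Lemma is_derive_along (W : 'rV[R]_N -> R) (x v : 'rV[R]_N) (t d : R) :
  is_derive (t *: v + x) v W d -> is_derive t (1 : R) (fun s => W (s *: v + x)) d.
Proof.
have E : (fun h : R => h^-1 *: (((fun s => W (s *: v + x)) \o shift t) (h *: (1 : R))
            - W (t *: v + x)))
       = (fun h => h^-1 *: ((W \o shift (t *: v + x)) (h *: v) - W (t *: v + x))).
  by apply/funext => h /=; rewrite [h *: 1]mulr1 scalerDl addrA.
case=> d1 d2; split.
  by move: d1; rewrite /derivable E.
by move: d2; rewrite /derive E.
Qed.

(** The integral of a translate of [W] does not depend on the translation;
    differentiate under the integral. *)
Lemma intg_partial_eq0 (W D : 'rV[R]_N -> R) (i : 'I_N) :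
  cube_bounded D -> integrable_rV W ->
  (forall x, is_derive x (delta_mx 0 i) W (D x)) -> intg D = 0.
Proof.
move=> [mD [C [M hC]]] sW dW.
have C0 x : 0 <= C * \1_(cube M) (x : 'rV[R]_N) by exact: le_trans (hC x).
pose e : 'rV[R]_N := delta_mx 0 i.
have H := @is_derive_intg R N (fun s x => W (s *: e + x)) (fun s x => D (s *: e + x)) 0
  (fun x => `|C| * \1_(cube (M + 1)) x).
have {H} : is_derive (0 : R) (1 : R) (fun s => intg (fun x => W (s *: e + x)))
    (intg (fun x => D (0 *: e + x))).
  apply: H.
  - by move=> s x _; apply: is_derive_along; exact: dW.
  - move=> s _; have := integrable_rV_affine (s *: e) ltr01 sW.
    by under eq_fun do rewrite scale1r.
  - move=> s x; rewrite subr0 => s1; apply: le_trans (hC _) _.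
    rewrite !indicE; case: (boolP (s *: e + x \in cube M)) => [|_]; last first.
      by rewrite mulr0 mulr_ge0.
    rewrite inE => Mx; rewrite mem_set ?mulr1 ?ler_norm// => j.
    have := Mx j; rewrite !mxE => h.
    have -> : x 0 j = (s * ((0 == 0 :> 'I_1) && (j == i))%:R + x 0 j) - s * ((0 == 0 :> 'I_1) && (j == i))%:R.
      by rewrite addrAC subrr add0r.
    apply: le_trans (ler_normB _ _) _; apply: lerD => //.
    by case: (j == i); rewrite /= ?mulr1 ?mulr0 ?normr0// ltW.
  - apply: integrable_rVZ; exact: integrable_rV_cube.
have -> : (fun s => intg (fun x : 'rV[R]_N => W (s *: e + x))) = cst (intg W).
  apply/funext => s; have := @intg_affine R N (s *: e) 1 W ltr01 sW.
  by under eq_fun do rewrite scale1r; rewrite expr1n invr1 mul1r.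
under eq_fun do rewrite scale0r add0r.
by move=> h; rewrite -(@derive_val _ _ _ _ _ _ _ h) derive_cst.
Qed.

(** Integration by parts: [u phi] has derivative [u (d_i phi) + (d_i u) phi],
    whose integral is 0. *)
Lemma H1_of_derivatives (u : 'rV[R]_N -> R) (g : 'rV[R]_N -> 'rV[R]_N) :
  cube_bounded u -> (forall i, cube_bounded (fun x => g x 0 i)) ->
  (forall i x, is_derive x (delta_mx 0 i) u (g x 0 i)) -> H1 u g.
Proof.
move=> bu bg dg; split.
- by apply: sqint_L2; exact: cube_bounded_sqint.
- by move=> i; apply: sqint_L2; exact: cube_bounded_sqint.
move=> i phi [sphi _].
have cphi : continuous phi by have [] := sphi [::].
have cdphi : continuous (partial i phi) by have [] := sphi [:: i].
have dphi x : is_derive x (delta_mx 0 i) phi (partial i phi x).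
  by apply: DeriveDef => //; have [_] := sphi [::]; apply.
have b1 : cube_bounded (fun x => u x * partial i phi x).
  by under eq_fun do rewrite mulrC; exact: cube_boundedM.
have b2 : cube_bounded (fun x => g x 0 i * phi x).
  by under eq_fun do rewrite mulrC; exact: cube_boundedM.
have b3 : cube_bounded (fun x => u x * phi x).
  by under eq_fun do rewrite mulrC; exact: cube_boundedM.
have s1 := integrable_cube_bounded b1; have s2 := integrable_cube_bounded b2.
have := @intg_partial_eq0 (fun x => u x * phi x)
  (fun x => u x * partial i phi x + g x 0 i * phi x) i (cube_boundedD b1 b2)
  (integrable_cube_bounded b3).
rewrite intgD// => H; rewrite -!EFin_intg// -EFinN; congr _%:E.
apply/eqP; rewrite -addr_eq0; apply/eqP; apply: H => x.
apply: is_derive_eq (is_deriveM (dg i x) (dphi x)) _.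
by rewrite -![_ *: _]/(_ * _) [phi x * _]mulrC.
Qed.

End parts.

(** * The trial function and its energy *)

Section profile.
Context {R : realType} {N : nat}.
Variables (L b : R).
Hypotheses (L0 : 0 < L) (bL : 1 < b - L) (N0 : (0 < N)%N).

Definition tau (t : R) : R := (t - b) / L.
Definition bump (t : R) : R := pospart (1 - tau t ^+ 2).

Lemma bump_neq0 t : bump t != 0 -> b - L <= t <= b + L.
Proof.
move=> h; have : 0 < 1 - tau t ^+ 2.
  by rewrite ltNge; apply: contra h => h; rewrite /bump /pospart max_l.
rewrite subr_gt0 -[ltRHS](expr1n _ 2) -(real_normK (num_real (tau t))).
rewrite ltr_pXn2r ?nnegrE// /tau normrM normfV (gtr0_norm L0) ltr_pdivrMr// mul1r.
rewrite ltr_norml => /andP[h1 h2]; apply/andP; split; lra.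
Qed.

Lemma bumpXS t k : bump t ^+ k.+2 = bump t ^+ k.+1 * (1 - tau t ^+ 2).
Proof. exact: pospartXS. Qed.

Lemma is_derive_tau t : is_derive t (1 : R) tau L^-1.
Proof.
have h := is_deriveM (is_deriveB (is_derive_id t (1 : R)) (is_derive_cst b t (1 : R)))
  (is_derive_cst L^-1 t (1 : R)).
apply: is_derive_eq h _.
by rewrite -![_ *: _]/(_ * _) mulr0 add0r subr0 mulr1.
Qed.

Lemma is_derive_bumpX k t : is_derive t (1 : R) (fun s => bump s ^+ k.+2)
  (k.+2%:R * bump t ^+ k.+1 * (- 2 * tau t / L)).
Proof.
have h := is_deriveB (is_derive_cst (1 : R) t (1 : R)) (is_deriveM (is_derive_tau t) (is_derive_tau t)).
have := @is_derive1_comp R (fun s => pospart s ^+ k.+2) _ t _ _ (is_derive_pospartX k _) h.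
move=> h'; apply: is_derive_eq h' _.
by rewrite -![_ *: _]/(_ * _) sub0r; congr (_ * _ * _); ring.
Qed.

Lemma continuous_tau : continuous tau.
Proof. exact: is_derive_continuous is_derive_tau. Qed.

Lemma continuous_bump : continuous bump.
Proof.
move=> t; apply: (@continuous_comp _ _ _ (fun t => 1 - tau t ^+ 2) pospart); last exact: continuous_pospart.
apply: cvgB; first exact: cvg_cst.
by apply: cvgM; exact: continuous_tau.
Qed.

Lemma continuous_tau_bump (j k : nat) : continuous (fun t => tau t ^+ j * bump t ^+ k).
Proof.
have cX (F : R -> R) n : continuous F -> continuous (fun t => F t ^+ n).
  move=> cF; elim: n => [|n IH] t; first exact: cvg_cst.
  under eq_fun do rewrite exprS.
  by apply: cvgM; [exact: cF|exact: IH].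
by move=> t; apply: cvgM; apply: cX; [exact: continuous_tau|exact: continuous_bump].
Qed.

Lemma tau_bump_neq0 (j k : nat) t : tau t ^+ j * bump t ^+ k.+1 != 0 -> b - L <= t <= b + L.
Proof.
by rewrite mulf_eq0 negb_or [bump t ^+ _ == 0]expf_eq0 /= => /andP[_ h]; exact: bump_neq0.
Qed.

Let bL0 : 0 < b - L. Proof. exact: lt_trans ltr01 bL. Qed.

Let sradint (j k : nat) :
  cube_bounded (fun x : 'rV[R]_N => expR (- (N%:R / 2 * ell x)) * (tau (ell x) ^+ j * bump (ell x) ^+ k.+1)).
Proof.
apply: (@weight_cube_bounded R N (fun t => tau t ^+ j * bump t ^+ k.+1) (b - L) (b + L)) => //.
  by move=> t; exact: tau_bump_neq0.
exact: continuous_tau_bump.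
Qed.

(** The integrals of the monomials in [tau] and [bump] that occur in the energy
    of the trial function. *)
Definition moment (j k : nat) : R := @radint R N (fun t => tau t ^+ j * bump t ^+ k).

Lemma radint_comb (j k j' k' : nat) (c d : R) :
  @radint R N (fun t => c * (tau t ^+ j * bump t ^+ k.+1) + d * (tau t ^+ j' * bump t ^+ k'.+1)) =
  c * moment j k.+1 + d * moment j' k'.+1.
Proof.
rewrite /moment /radint -!intgZ; try exact: (integrable_cube_bounded (sradint _ _)).
rewrite -intgD; try by apply: integrable_rVZ; exact: (integrable_cube_bounded (sradint _ _)).
by congr intg; apply/funext => x; ring.
Qed.

(** [radint_derive] for primitives [F] whose derivative has two monomials. *)
Lemma moment_derive (j k j' k' : nat) (c d : R) (F : R -> R) :
  (forall t, F t != 0 -> b - L <= t <= b + L) ->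
  (forall t, is_derive t (1 : R) F (c * (tau t ^+ j * bump t ^+ k.+1) + d * (tau t ^+ j' * bump t ^+ k'.+1))) ->
  c * moment j k.+1 + d * moment j' k'.+1 = 0.
Proof.
move=> hF dF; rewrite -radint_comb.
apply: (radint_derive bL dF) => //.
- move=> t; apply: cvgD; (apply: cvgM; [exact: cvg_cst|exact: continuous_tau_bump]).
- exact: hF.
- move=> t /=; have [E|] := eqVneq (bump t) 0; last by move=> h _; exact: bump_neq0.
  by rewrite E !expr0n /= !mulr0 addr0 eqxx.
Qed.

(** The monomial is the derivative of [bump^4] up to a factor. *)
Lemma moment13 : moment 1 3 = 0.
Proof.
have := @moment_derive 1 2 1 2 (- 8 / L) 0 (fun t => bump t ^+ 4).
rewrite mul0r addr0 => H.
have /eqP : - 8 / L * moment 1 3 = 0.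
  apply: H => t.
    by rewrite expf_eq0 /= => h; exact: bump_neq0.
  apply: is_derive_eq (is_derive_bumpX 2 t) _.
  by rewrite expr1; field; rewrite gt_eqF.
rewrite mulf_eq0 => /orP[|/eqP//].
by rewrite mulf_eq0 invr_eq0 (gt_eqF L0) orbF oppr_eq0 pnatr_eq0.
Qed.

(** From the primitive [tau bump^3]. *)
Lemma moment22 : 6 * moment 2 2 = moment 0 3.
Proof.
have H : L^-1 * moment 0 3 + (- 6 / L) * moment 2 2 = 0.
  apply: (@moment_derive 0 2 2 1 _ _ (fun t => tau t * bump t ^+ 3)).
    move=> t h; apply: (@tau_bump_neq0 1 2); by rewrite expr1.
  move=> t; apply: is_derive_eq (is_deriveM (is_derive_tau t) (is_derive_bumpX 1 t)) _.
  by rewrite -![_ *: _]/(_ * _) expr0 mul1r; field; rewrite gt_eqF.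
have : L * (L^-1 * moment 0 3 + (- 6 / L) * moment 2 2) = moment 0 3 - 6 * moment 2 2.
  by field; rewrite gt_eqF.
by rewrite H mulr0 => /eqP; rewrite eq_sym subr_eq0 => /eqP.
Qed.

(** From the primitive [tau bump^4], using [tau^2 bump^3 = bump^3 - bump^4]. *)
Lemma moment03 : 8 * moment 0 3 = 9 * moment 0 4.
Proof.
have H : (9 / L) * moment 0 4 + (- 8 / L) * moment 0 3 = 0.
  apply: (@moment_derive 0 3 0 2 _ _ (fun t => tau t * bump t ^+ 4)).
    move=> t h; apply: (@tau_bump_neq0 1 3); by rewrite expr1.
  move=> t; apply: is_derive_eq (is_deriveM (is_derive_tau t) (is_derive_bumpX 2 t)) _.
  rewrite -![_ *: _]/(_ * _) expr0 !mul1r (bumpXS t 2).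
  by field; rewrite gt_eqF.
have : L * ((9 / L) * moment 0 4 + (- 8 / L) * moment 0 3) = 9 * moment 0 4 - 8 * moment 0 3.
  by field; rewrite gt_eqF.
by rewrite H mulr0 => /eqP; rewrite eq_sym subr_eq0 => /eqP.
Qed.

Let m : R := (N%:R - 2) / 2.

(** The factor [e^(-(m/2)t)] is [|x|^(-(N-2)/2)], the homogeneous function for
    which the two sides of the Hardy inequality have the same density, with
    infinite integrals; the square of [bump] cuts it off in a continuously
    differentiable way. *)
Definition profile (t : R) : R := expR (- (m / 2 * t)) * bump t ^+ 2.

Definition dprofile (t : R) : R :=
  expR (- (m / 2 * t)) * (- (m / 2) * bump t ^+ 2 - 4 / L * (tau t * bump t)).

Lemma is_derive_profile t : is_derive t (1 : R) profile (dprofile t).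
Proof.
apply: is_derive_eq (is_deriveM (is_derive_expRN (m / 2) t) (is_derive_bumpX 0 t)) _.
by rewrite -![_ *: _]/(_ * _) expr1 /dprofile; ring.
Qed.

Lemma continuous_dprofile : continuous dprofile.
Proof.
move=> t; apply: cvgM; first exact: continuous_expRN.
apply: cvgB; (apply: cvgM; first exact: cvg_cst).
  exact: (is_derive_continuous (is_derive_bumpX 0)).
by apply: cvgM; [exact: continuous_tau|exact: continuous_bump].
Qed.

Lemma profile_neq0 t : profile t != 0 -> b - L <= t <= b + L.
Proof.
by rewrite mulf_eq0 negb_or expf_eq0 /= => /andP[_ h]; exact: bump_neq0.
Qed.

Lemma dprofile_neq0 t : dprofile t != 0 -> b - L <= t <= b + L.
Proof.
move=> h; apply: bump_neq0; apply: contra h => /eqP E.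
by rewrite /dprofile E expr0n /= !mulr0 subr0 mulr0.
Qed.

Definition trial (x : 'rV[R]_N) : R := profile (ell x).

Definition grad_trial (x : 'rV[R]_N) : 'rV[R]_N :=
  \row_i (2 * x 0 i * (expR (- (1 * ell x)) * dprofile (ell x))).

Lemma cube_bounded_trial : cube_bounded trial.
Proof.
apply: (@log_radial_cube_bounded R N profile (b - L) (b + L)) => //.
  exact: profile_neq0.
exact: is_derive_continuous is_derive_profile.
Qed.

Lemma cube_bounded_grad i : cube_bounded (fun x => grad_trial x 0 i).
Proof.
under eq_fun do rewrite mxE.
apply: (cube_boundedM (h := fun x : 'rV[R]_N => 2 * x 0 i)).
  apply: continuous_elementary; apply: elementaryM; [exact: elementary_cst|exact: elementary_coord].
apply: (@log_radial_cube_bounded R N (fun t => expR (- (1 * t)) * dprofile t) (b - L) (b + L)) => //.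
  by move=> t; rewrite mulf_eq0 negb_or => /andP[_]; exact: dprofile_neq0.
by move=> t; apply: cvgM; [exact: continuous_expRN|exact: continuous_dprofile].
Qed.

Lemma norm2_line (x : 'rV[R]_N) i s :
  norm2 (s *: delta_mx 0 i + x) = norm2 x + s * (2 * x 0 i + s).
Proof.
rewrite /norm2 (bigD1 i)//= [in RHS](bigD1 i)//= !mxE !eqxx mulr1.
rewrite (eq_bigr (fun j => x 0 j ^+ 2)) => [|j ji]; first by ring.
by rewrite !mxE (negbTE ji) andbF mulr0 add0r.
Qed.

Lemma is_derive_trial i x : is_derive x (delta_mx 0 i) trial (grad_trial x 0 i).
Proof.
have [x0|x0] := ltP 0 (norm2 x).
  apply: is_derive_line.
  have h1 : is_derive (0 : R) (1 : R) (fun s => norm2 (s *: delta_mx 0 i + x)) (2 * x 0 i).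
    have -> : (fun s => norm2 (s *: delta_mx 0 i + x)) = fun s => norm2 x + s * (2 * x 0 i + s).
      by apply/funext => s; exact: norm2_line.
    have h := is_deriveD (is_derive_cst (norm2 x) (0 : R) (1 : R))
      (is_deriveM (is_derive_id (0 : R) (1 : R))
         (is_deriveD (is_derive_cst (2 * x 0 i) (0 : R) (1 : R)) (is_derive_id (0 : R) (1 : R)))).
    apply: is_derive_eq h _.
    by rewrite -![_ *: _]/(_ * _) /= mul0r !add0r mulr1 -[LHS]/(2 * x 0 i + 0) addr0.
  have x0' : 0 < norm2 (0 *: delta_mx 0 i + x) by rewrite scale0r add0r.
  have h2 := @is_derive1_comp R (@ln R) _ 0 _ _ (is_derive1_ln x0') h1.
  have h3 := @is_derive1_comp R profile _ 0 _ _ (is_derive_profile _) h2.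
  apply: is_derive_eq h3 _.
  rewrite /= scale0r add0r mxE mul1r expRN /ell lnK ?posrE//; ring.
have n0 : norm2 x = 0 by apply/eqP; rewrite eq_le x0 norm2_ge0.
have small (y : 'rV[R]_N) : norm2 y < 1 -> ~~ (b - L <= ell y <= b + L).
  move=> y1; rewrite negb_and -ltNge; apply/orP; left.
  by apply: le_lt_trans bL0; rewrite /ell ln_le0// ltW.
have -> : grad_trial x 0 i = 0.
  rewrite mxE; have [->|/dprofile_neq0 h] := eqVneq (dprofile (ell x)) 0; first by rewrite !mulr0.
  by have := small x; rewrite n0 ltr01 h => /(_ isT).
apply: (@near_eq_is_derive _ _ _ (cst (0 : R))).
have : open [set y : 'rV[R]_N | norm2 y < 1].
  rewrite -preimage_itvNyo; move: (@continuous_norm2 R N) => /continuousP; apply.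
  exact: lray_open.
move=> o1; have nx := open_nbhs_nbhs (conj o1 (_ : [set y | norm2 y < 1] x)).
have {}nx := nx ltac:(by rewrite /= n0).
near=> y.
have y1 : norm2 y < 1 by near: y.
rewrite /trial; have [->//|/profile_neq0 h] := eqVneq (profile (ell y)) 0.
by have := small y y1; rewrite h.
Unshelve. all: by end_near. Qed.

Lemma H1_trial : H1 trial grad_trial.
Proof.
apply: H1_of_derivatives.
- exact: cube_bounded_trial.
- exact: cube_bounded_grad.
- exact: is_derive_trial.
Qed.

Lemma trial_ratio x :
  trial x ^+ 2 / norm2 x = expR (- (N%:R / 2 * ell x)) * bump (ell x) ^+ 4.
Proof.
rewrite /trial /profile; have [->|h] := eqVneq (bump (ell x)) 0.
  by rewrite !expr0n /= !mulr0 expr0n mul0r.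
have /andP[h1 _] := bump_neq0 h.
rewrite norm2E; last exact: lt_le_trans h1.
rewrite exprMn -exprM mulrAC; congr (_ * _).
by rewrite -expRN -expRM_natl -expRD; congr expR; rewrite /m; field.
Qed.

Lemma integrable_trial_ratio : integrable_rV (fun x => trial x ^+ 2 / norm2 x).
Proof.
have := integrable_cube_bounded (sradint 0 3).
congr integrable_rV; apply/funext => x.
by rewrite trial_ratio expr0 mul1r.
Qed.

Lemma intg_trial_ratio : intg (fun x => trial x ^+ 2 / norm2 x) = moment 0 4.
Proof.
by congr intg; apply/funext => x; rewrite trial_ratio expr0 mul1r.
Qed.

Lemma norm2_grad_trial x : norm2 (grad_trial x) =
  expR (- (N%:R / 2 * ell x)) * (m ^+ 2 * bump (ell x) ^+ 4 + 16 * m / L * (tau (ell x) * bump (ell x) ^+ 3)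
     + 64 / L ^+ 2 * (tau (ell x) ^+ 2 * bump (ell x) ^+ 2)).
Proof.
have -> : norm2 (grad_trial x) = 4 * norm2 x * (expR (- (1 * ell x)) * dprofile (ell x)) ^+ 2.
  rewrite /norm2 mulr_sumr mulr_suml; apply: eq_bigr => i _.
  by rewrite mxE; ring.
rewrite /dprofile; have [->|h] := eqVneq (bump (ell x)) 0.
  by rewrite !expr0n /= !mulr0 subrr !mulr0 expr0n /= mulr0 !addr0 mulr0.
have /andP[h1 _] := bump_neq0 h.
rewrite norm2E; last exact: lt_le_trans h1.
have -> : expR (- (N%:R / 2 * ell x)) =
    expR (ell x) * (expR (- (1 * ell x)) * expR (- (m / 2 * ell x))) ^+ 2.
  by rewrite -expRD -expRM_natl -expRD; congr expR; rewrite /m; field.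
by field; rewrite gt_eqF.
Qed.

(** The cross term is a multiple of [moment 1 3], which vanishes; the identities
    for the moments reduce the last one to [moment 0 4]. *)
Lemma energy_trial :
  intg (fun x => norm2 (grad_trial x)) = (m ^+ 2 + 12 / L ^+ 2) * moment 0 4.
Proof.
have s j k := integrable_cube_bounded (sradint j k).
have -> : (fun x => norm2 (grad_trial x)) = fun x =>
  m ^+ 2 * (expR (- (N%:R / 2 * ell x)) * (tau (ell x) ^+ 0 * bump (ell x) ^+ 4)) +
  (16 * m / L * (expR (- (N%:R / 2 * ell x)) * (tau (ell x) ^+ 1 * bump (ell x) ^+ 3)) +
  64 / L ^+ 2 * (expR (- (N%:R / 2 * ell x)) * (tau (ell x) ^+ 2 * bump (ell x) ^+ 2))).
  by apply/funext => x; rewrite norm2_grad_trial expr0 expr1; ring.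
rewrite intgD; [|exact/integrable_rVZ|by apply: integrable_rVD; exact/integrable_rVZ].
rewrite intgD; [|exact/integrable_rVZ|exact/integrable_rVZ].
rewrite !intgZ//.
rewrite -/(radint _) -/(moment 0 4) -[X in _ + (_ * X + _)]/(moment 1 3) moment13 mulr0 add0r.
rewrite -[X in _ + _ * X]/(moment 2 2).
have : 16 * (3 * moment 2 2 - 9 / 16 * moment 0 4) = 0.
  have := moment22; have := moment03; lra.
have L2 : L ^+ 2 != 0 by rewrite expf_neq0// gt_eqF.
move=> h; have -> : moment 2 2 = 3 / 16 * moment 0 4 by lra.
rewrite -[X in m ^+ 2 * X]/(moment 0 4); by field; rewrite gt_eqF.
Qed.

(** On a box on which [tau] runs in [[0, 1/2]] the integrand is bounded below. *)
Lemma moment04_gt0 : 0 < moment 0 4.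
Proof.
have NR : 0 < N%:R :> R by rewrite ltr0n.
(* The points with all coordinates equal to s t have norm2 = e^t. *)
pose s (t : R) : R := Num.sqrt (expR t / N%:R).
have s2 t : N%:R * s t ^+ 2 = expR t.
  by rewrite sqr_sqrtr ?divr_ge0 ?expR_ge0 ?ler0n// mulrCA mulfV ?mulr1// gt_eqF.
pose s0 := s b; pose s1 := s (b + L / 2).
have s01 : s0 < s1.
  by rewrite /s0 /s1 ltr_sqrt ?divr_gt0 ?expR_gt0// ltr_pM2r ?invr_gt0// ltr_expR ltrDl divr_gt0.
pose A := [set x : 'rV[R]_N | forall i, `[s0, s1]%classic (x 0 i)].
have mA : measurable A.
  by apply: (measurable_box (A := fun=> `[s0, s1]%classic)) => i; exact: measurable_itv.
have muA : leb_rV R N A = ((s1 - s0) ^+ N)%:E.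
  rewrite (leb_rV_box (A := fun=> `[s0, s1]%classic)); last by move=> i; exact: measurable_itv.
  rewrite (eq_bigr (fun=> (s1 - s0)%:E)) => [|i _].
    by rewrite prodEFin prodr_const card_ord.
  by rewrite lebesgue_measure_itv/= lte_fin s01 -EFinB.
have EA : (\int[leb_rV R N]_x (\1_A x)%:E = ((s1 - s0) ^+ N)%:E)%E.
  by rewrite integral_indic ?setIT//; exact: muA.
have iA : intg \1_A = (s1 - s0) ^+ N by rewrite /intg /Rintegral EA.
have sA : integrable_rV \1_A.
  apply: integrable_rV_ge0.
  - by apply: measurable_indic.
  - by move=> x.
  - by rewrite EA ltry.
pose c : R := expR (- (N%:R / 2 * (b + L / 2))) * (3 / 4) ^+ 4.
have c0 : 0 < c by rewrite mulr_gt0 ?expR_gt0// exprn_gt0// divr_gt0.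
have lower x : c * \1_A x <= expR (- (N%:R / 2 * ell x)) * (tau (ell x) ^+ 0 * bump (ell x) ^+ 4).
  rewrite indicE; case: (boolP (x \in A)) => [|_]; last first.
    by rewrite mulr0 expr0 mul1r mulr_ge0 ?expR_ge0// exprn_ge0// pospart_ge0.
  rewrite inE mulr1 expr0 mul1r => Ax.
  have bd i : s0 ^+ 2 <= x 0 i ^+ 2 <= s1 ^+ 2.
    have := Ax i; rewrite /= in_itv /= => /andP[h1 h2].
    have s00 : 0 <= s0 by exact: sqrtr_ge0.
    by apply/andP; split; apply: lerXn2r; rewrite ?nnegrE ?sqrtr_ge0// (le_trans s00).
  have n1 : expR b <= norm2 x.
    rewrite -s2 -/s0 (_ : N%:R * s0 ^+ 2 = \sum_(i < N) s0 ^+ 2).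
      by apply: ler_sum => i _; case/andP: (bd i).
    by rewrite sumr_const card_ord mulr_natl.
  have n2 : norm2 x <= expR (b + L / 2).
    rewrite -s2 -/s1 (_ : N%:R * s1 ^+ 2 = \sum_(i < N) s1 ^+ 2).
      by apply: ler_sum => i _; case/andP: (bd i).
    by rewrite sumr_const card_ord mulr_natl.
  have np : 0 < norm2 x by apply: lt_le_trans n1; rewrite expR_gt0.
  have e1 : b <= ell x by rewrite -ler_expR lnK ?posrE.
  have e2 : ell x <= b + L / 2 by rewrite -ler_expR lnK ?posrE.
  apply: ler_pM; rewrite ?expR_ge0 ?exprn_ge0//.
    by rewrite ler_expR lerN2 ler_wpM2l// divr_ge0.
  apply: lerXn2r; rewrite ?nnegrE ?pospart_ge0//.
  rewrite /bump /pospart le_max; apply/orP; right.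
  have t1 : 0 <= tau (ell x) by rewrite divr_ge0 ?subr_ge0// ltW.
  have t2 : tau (ell x) <= 1 / 2.
    by rewrite /tau ler_pdivrMr// lerBlDl mul1r mulrC.
  nra.
apply: (@lt_le_trans _ _ (c * (s1 - s0) ^+ N)).
  by rewrite mulr_gt0// exprn_gt0// subr_gt0.
rewrite -iA -intgZ//; apply: le_intg => //; first exact: integrable_rVZ.
exact: integrable_cube_bounded (sradint 0 3).
Qed.

End profile.

(** * Several poles *)

Section multipolar.
Context {R : realType} {N n : nat}.
Hypothesis hN : (3 <= N)%N.
Variables (a : 'I_n -> 'rV[R]_N) (alpha : 'I_n -> R).
Hypotheses (alpha_ge0 : forall i, 0 <= alpha i) (alpha_sum : \sum_(i < n) alpha i = 1).

Definition pole_integral (u : 'rV[R]_N -> R) (p : 'rV[R]_N) : \bar R :=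
  (\int[leb_rV R N]_x (`|u x| ^+ 2 / enorm (x - p) ^+ 2)%:E)%E.

Lemma pole_integral_ge0 u p : (0 <= pole_integral u p)%E.
Proof. by apply: integral_ge0 => x _; rewrite lee_fin divr_ge0 ?sqr_ge0. Qed.

Lemma measurable_pole (u : 'rV[R]_N -> R) (p : 'rV[R]_N) : measurable_fun setT u ->
  measurable_fun setT (fun x => (`|u x| ^+ 2 / enorm (x - p) ^+ 2)%:E).
Proof.
move=> mu; apply/measurable_EFinP; under eq_fun do rewrite enorm_sqr.
apply: measurable_funM; last exact: measurable_norm2V.
by apply: measurable_funX; apply: measurableT_comp.
Qed.

Lemma pole_integralZ (u : 'rV[R]_N -> R) (p : 'rV[R]_N) (k : R) : measurable_fun setT u -> 0 <= k ->
  (\int[leb_rV R N]_x (k * (`|u x| ^+ 2 / enorm (x - p) ^+ 2))%:E = k%:E * pole_integral u p)%E.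
Proof.
move=> mu k0; under eq_integral do rewrite EFinM.
rewrite ge0_integralZl//; first exact: measurable_pole.
by move=> x _; rewrite lee_fin divr_ge0 ?sqr_ge0.
Qed.

Lemma weighted_hardy u g : H1 u g ->
  (((N%:R - 2) ^+ 2 / 4)%:E * \sum_(i < n) (alpha i)%:E * pole_integral u (a i)
    <= \int[leb_rV R N]_x (enorm (g x) ^+ 2)%:E)%E.
Proof.
move=> ug; set c := (N%:R - 2) ^+ 2 / 4; set G := integral _ _ _.
have c0 : 0 <= c by rewrite divr_ge0// sqr_ge0.
rewrite ge0_sume_distrr; last by move=> i _; rewrite mule_ge0 ?lee_fin ?pole_integral_ge0.
apply: (@le_trans _ _ (\sum_(i < n) (alpha i)%:E * G)%E).
  by apply: lee_sum => i _; rewrite muleCA lee_wpmul2l ?lee_fin//; exact: hardy.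
rewrite -ge0_sume_distrl; last by move=> i _; rewrite lee_fin.
by rewrite sumEFin alpha_sum mul1e.
Qed.

Lemma norm2_shift_le (x p : 'rV[R]_N) (t : R) : 0 < t ->
  norm2 (x - p) <= (1 + t) * norm2 x + (1 + t^-1) * norm2 p.
Proof.
move=> t0; rewrite /norm2 !mulr_sumr -big_split /=; apply: ler_sum => i _.
rewrite !mxE; have := @young R (x 0 i) (p 0 i) t t0.
have := ler_norm (- (x 0 i * p 0 i)); rewrite normrN; nra.
Qed.

(** The support of the trial function lies in [{ell >= b - L}], where [norm2 x]
    is large compared with all [norm2 (a i)]; there the quotients with pole [a i]
    are at least [1/(1 + eta)] times those with pole 0. *)
Lemma weighted_sharp (C : R) : (N%:R - 2) ^+ 2 / 4 < C ->
  exists (u : 'rV[R]_N -> R) (g : 'rV[R]_N -> 'rV[R]_N), H1 u g /\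
  ~ (C%:E * \sum_(i < n) (alpha i)%:E * pole_integral u (a i)
    <= \int[leb_rV R N]_x (enorm (g x) ^+ 2)%:E)%E.
Proof.
set c := (N%:R - 2) ^+ 2 / 4 => cC.
have c0 : 0 <= c by rewrite divr_ge0// sqr_ge0.
have C0 : 0 < C by exact: le_lt_trans cC.
pose d := C - c; have d0 : 0 < d by rewrite subr_gt0.
(* L >= 1 and L >= 48/d, hence 12/L^2 <= d/4: a quarter of the room goes to L,
   and another quarter to eta. *)
pose L := 1 + 48 / d.
have L1 : 1 <= L by rewrite lerDl divr_ge0// ltW.
have L0 : 0 < L by exact: lt_le_trans L1.
have dL : 12 / L ^+ 2 <= d / 4.
  rewrite ler_pdivrMr ?exprn_gt0//.
  apply: (@le_trans _ _ (d / 4 * L)); last first.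
    by rewrite ler_wpM2l ?divr_ge0 ?(ltW d0)// expr2 ler_peMl// ltW.
  rewrite /L (_ : d / 4 * (1 + 48 / d) = d / 4 + 12) ?lerDr ?divr_ge0 ?(ltW d0)//.
  by field; rewrite gt_eqF.
pose eta := d / (4 * C).
have eta0 : 0 < eta by rewrite divr_gt0// mulr_gt0.
have etaC : eta * C = d / 4 by rewrite /eta; field; rewrite gt_eqF.
have eta1 : eta <= 1.
  rewrite /eta ler_pdivrMr ?mulr_gt0// mul1r /d; lra.
(* If norm2 x >= K norm2 (a i), then expanding norm2 (x - a i) with Young's
   inequality of parameter eta/2 gives at most (1 + eta) norm2 x. As K >= 1 and
   the inequality is strict on the support, no pole belongs to the support. *)
pose K := 2 / eta * (1 + 2 / eta).
have eta2 : 1 <= 2 / eta by rewrite ler_pdivlMr// mul1r; lra.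
have K1 : 1 <= K by rewrite /K; nra.
have K0 : 0 <= K by exact: le_trans K1.
pose A := K * \sum_(i < n) norm2 (a i).
have aA i : K * norm2 (a i) <= A.
  by rewrite ler_wpM2l// (bigD1 i)//= lerDl sumr_ge0// => j _; exact: norm2_ge0.
have A0 : 0 <= A by rewrite mulr_ge0// sumr_ge0// => j _; exact: norm2_ge0.
(* On the support norm2 x = e^(ell x) >= 1 + (b - L) > A. *)
pose b := L + 2 + A.
have bL : 1 < b - L by rewrite /b; lra.
have N0 : (0 < N)%N by exact: leq_trans hN.
pose u := @trial R N L b; pose g := @grad_trial R N L b.
pose J := @moment R N L b 0 4.
have J0 : 0 < J by exact: moment04_gt0.
have ug : H1 u g by exact: H1_trial.
have mu : measurable_fun setT u by have [] := cube_bounded_trial (N := N) L0 bL.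
exists u, g; split=> // H.
have EG : (\int[leb_rV R N]_x (enorm (g x) ^+ 2)%:E = ((c + 12 / L ^+ 2) * J)%:E)%E.
  have -> : c + 12 / L ^+ 2 = ((N%:R - 2) / 2) ^+ 2 + 12 / L ^+ 2.
    by congr (_ + _); rewrite /c; field.
  rewrite -energy_trial// EFin_intg; last first.
    apply: integrable_rV_sum => i; exact: (cube_bounded_sqint (cube_bounded_grad L0 bL i)).2.
  by apply: eq_integral => x _; rewrite enorm_sqr.
have lower i : (((1 + eta)^-1 * J)%:E <= pole_integral u (a i))%E.
  rewrite /J -intg_trial_ratio//.
  have sw := @integrable_trial_ratio R N L b L0 bL.
  rewrite -intgZ// EFin_intg; last exact: integrable_rVZ.
  have e0 : 0 <= (1 + eta)^-1 by rewrite invr_ge0 addr_ge0// ltW.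
  apply: ge0_le_integral => //.
  - by move=> x _; rewrite lee_fin mulr_ge0// divr_ge0 ?sqr_ge0 ?norm2_ge0.
  - by apply/measurable_EFinP; apply: measurable_integrable_rV; exact: integrable_rVZ.
  - exact: measurable_pole.
  move=> x _; rewrite lee_fin enorm_sqr real_normK ?num_real// -/u.
  have [->|ux] := eqVneq (u x) 0; first by rewrite expr0n /= !mul0r mulr0.
  have /andP[h1 _] := profile_neq0 L0 ux.
  have Lx : A < norm2 x.
    rewrite norm2E; last by lra.
    apply: (@lt_le_trans _ _ (1 + ell x)); first by rewrite /b in h1; lra.
    exact: expR_ge1Dx.
  have nx : 0 < norm2 x by exact: le_lt_trans Lx.
  have nxa : norm2 (x - a i) <= (1 + eta) * norm2 x.
    apply: le_trans (norm2_shift_le x (a i) (_ : 0 < eta / 2)) _; first by rewrite divr_gt0.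
    rewrite invf_div mulrDl mul1r [leRHS]mulrDl mul1r -addrA lerD2l.
    have : (1 + 2 / eta) * norm2 (a i) <= eta / 2 * norm2 x.
      have e2 : 0 < 2 / eta by rewrite divr_gt0.
      rewrite -(ler_pM2l e2) mulrA -/K.
      rewrite (_ : 2 / eta * (eta / 2 * norm2 x) = norm2 x); last by field; rewrite gt_eqF.
      by apply: le_trans (aA i) _; exact: ltW.
    lra.
  have nxa0 : 0 < norm2 (x - a i).
    rewrite lt_def norm2_ge0 andbT; apply/negP => /eqP E.
    have xa : x = a i.
      apply/rowP => j; apply/eqP; rewrite -subr_eq0 -sqrf_eq0.
      move: E => /eqP; rewrite psumr_eq0; last by move=> k _; rewrite sqr_ge0.
      by move=> /allP /(_ j); rewrite mem_index_enum !mxE => /(_ isT).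
    have := aA i; rewrite -xa => h.
    have : norm2 x <= K * norm2 x by rewrite ler_peMl// norm2_ge0.
    lra.
  rewrite mulrCA ler_wpM2l ?sqr_ge0// -invfM lef_pV2 ?posrE//.
  by rewrite mulr_gt0// addr_gt0.
have : (C%:E * ((1 + eta)^-1 * J)%:E <= ((c + 12 / L ^+ 2) * J)%:E)%E.
  rewrite -EG; apply: le_trans H; rewrite lee_wpmul2l ?lee_fin ?(ltW C0)//.
  apply: (@le_trans _ _ (\sum_(i < n) (alpha i)%:E * ((1 + eta)^-1 * J)%:E)%E).
    rewrite -ge0_sume_distrl; last by move=> i _; rewrite lee_fin.
    by rewrite sumEFin alpha_sum mul1e.
  by apply: lee_sum => i _; rewrite lee_wpmul2l ?lee_fin.
rewrite -EFinM lee_fin mulrA ler_pM2r// ler_pdivrMr ?addr_gt0//.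
rewrite /d in d0 dL etaC.
nra.
Qed.

End multipolar.

Theorem corollary2p4 (R : realType) (N n : nat) (hN : (3 <= N)%N)
    (hn : (1 <= n)%N) (a : 'I_n -> 'rV[R]_N) (ha : injective a)
    (alpha : 'I_n -> R) (halpha : forall i, 0 <= alpha i)
    (halpha1 : \sum_(i < n) alpha i = 1) :
  [/\ (forall (u : 'rV[R]_N -> R) (gradu : 'rV[R]_N -> 'rV[R]_N), H1 u gradu ->
        (((N%:R - 2) ^+ 2 / 4)%:E *
           \sum_(i < n) \int[leb_rV R N]_x
             (alpha i * (`|u x| ^+ 2 / enorm (x - a i) ^+ 2))%:E
         <= \int[leb_rV R N]_x (enorm (gradu x) ^+ 2)%:E)%E),
      (forall C : R, (N%:R - 2) ^+ 2 / 4 < C ->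
        exists (u : 'rV[R]_N -> R) (gradu : 'rV[R]_N -> 'rV[R]_N), H1 u gradu /\
        ~ (C%:E *
             \sum_(i < n) \int[leb_rV R N]_x
               (alpha i * (`|u x| ^+ 2 / enorm (x - a i) ^+ 2))%:E
           <= \int[leb_rV R N]_x (enorm (gradu x) ^+ 2)%:E)%E),
      (forall (u : 'rV[R]_N -> R) (gradu : 'rV[R]_N -> 'rV[R]_N), H1 u gradu ->
        (((N%:R - 2) ^+ 2 / (4 * n%:R))%:E *
           \sum_(i < n) \int[leb_rV R N]_x
             (`|u x| ^+ 2 / enorm (x - a i) ^+ 2)%:E
         <= \int[leb_rV R N]_x (enorm (gradu x) ^+ 2)%:E)%E) &
      (forall C : R, (N%:R - 2) ^+ 2 / (4 * n%:R) < C ->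
        exists (u : 'rV[R]_N -> R) (gradu : 'rV[R]_N -> 'rV[R]_N), H1 u gradu /\
        ~ (C%:E *
             \sum_(i < n) \int[leb_rV R N]_x
               (`|u x| ^+ 2 / enorm (x - a i) ^+ 2)%:E
           <= \int[leb_rV R N]_x (enorm (gradu x) ^+ 2)%:E)%E)].
Proof.
have n0 : 0 < n%:R :> R by rewrite ltr0n.
have sumn : \sum_(i < n) (n%:R^-1 : R) = 1.
  by rewrite sumr_const card_ord -[LHS]mulr_natl divff// gt_eqF.
have nV i : 0 <= (fun _ : 'I_n => n%:R^-1 : R) i by rewrite invr_ge0 ltW.
have mH1 u g : H1 u g -> measurable_fun setT u.
  by move=> -[/L2_sqint []].
have E1 u g (ug : @H1 R N u g) :
    (\sum_(i < n) \int[leb_rV R N]_x (alpha i * (`|u x| ^+ 2 / enorm (x - a i) ^+ 2))%:E =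
     \sum_(i < n) (alpha i)%:E * pole_integral u (a i))%E.
  by apply: eq_bigr => i _; rewrite pole_integralZ//; exact: mH1 ug.
have E2 (c : R) u : (c%:E * \sum_(i < n) \int[leb_rV R N]_x (`|u x| ^+ 2 / enorm (x - a i) ^+ 2)%:E =
     (c * n%:R)%:E * \sum_(i < n) (n%:R^-1)%:E * pole_integral u (a i))%E.
  rewrite -ge0_sume_distrr; last by move=> i _; exact: pole_integral_ge0.
  by rewrite muleA -EFinM mulfK// gt_eqF.
split.
- by move=> u g ug; rewrite (E1 _ _ ug); exact: weighted_hardy ug.
- move=> C /(weighted_sharp hN a halpha halpha1)[u [g [ug h]]].
  by exists u, g; split=> //; rewrite (E1 _ _ ug).
- move=> u g ug; rewrite E2 (_ : _ / (4 * n%:R) * n%:R = (N%:R - 2) ^+ 2 / 4); last first.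
    by field; rewrite gt_eqF.
  exact: weighted_hardy ug.
- move=> C hC.
  have hC' : (N%:R - 2) ^+ 2 / 4 < C * n%:R.
    by rewrite -ltr_pdivrMr// -mulrA -invfM.
  have [u [g [ug h]]] := weighted_sharp hN a nV sumn hC'.
  by exists u, g; split=> //; rewrite E2.
Qed.
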